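(* For every odd integer $N\ge 1$ and every $\epsilon>0$, there is a multi-twist folded ribbon Möbius band with $N$ half-twists (that is, a folded ribbon unknot that is topologically a Möbius band and has ribbon linking number $\pm N$) whose folded ribbonlength equals $3\sqrt{3}+\epsilon$. Moreover, this Möbius band is constructed from an escape accordion followed by half-wraps, each with fold angle $\pi/3$ (with the ends of the ribbon folded behind the escape accordion and joined).
   Context: **Folded ribbon knots.** A folded ribbon knot $K_w$ of width $w>0$ is obtained from a polygonal knot diagram $K$ in the plane (a closed polygon with finitely many straight edges and crossing information; edges may overlap in projection) by placing two lines parallel to each edge at distance $w/2$, one on each side. At each vertex with fold angle $\theta\in[0,\pi]$ (the angle between the two adjacent edges) a fold line is added that is centered at the vertex and perpendicular to the bisector of the fold angle; the fold line acts as a mirror reflecting the adjacent edges' ribbon strips into each other. The result is required to be a piecewise-linear immersion into the plane of an embedded (possibly knotted) Möbius band or annulus, with singularities exactly the fold lines, together with continuous over/under (layering) information consistent with the crossing information of $K$. The knot type of $K_w$ is that of $K$; a folded ribbon unknot is one whose diagram is an unknot. The folded ribbonlength is $\mathrm{Rib}(K_w)=\mathrm{Len}(K)/w$. The ribbon linking number $\mathrm{Lk}(K_w)$ is the linking number between the (oriented) knot diagram and one boundary component of the ribbon. All ribbons here have width $w=1$. **Folds.** Orient the knot. A fold is left (right) if the diagram turns left (right) at the vertex. It is an overfold (underfold) if the ribbon leaving the fold lies over (under) the ribbon entering it. **Accordion fold, escape accordion.** An accordion fold with fold angle $\theta$ and distance $d$ is an alternating sequence of left and right overfolds (starting with a left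 overfold), each with fold angle $\theta$, with constant distance $d$ between consecutive vertices of the knot diagram. An escape accordion is an accordion fold with an even number $k=2m$ of folds such that the parallel pieces of ribbon entering and leaving it are at least distance $1$ apart. Its start vertex is $v_S$ and its end vertex is $v_E$; in the diagram $v_S$ and $v_E$ are joined by a zigzag of $k$ segments of length $d$. **Half-wraps.** After the escape accordion, half-wraps continue the same zigzag of the diagram, from the vertex $w_1=v_E$ through vertices $w_2,w_3,\dots$, with the same fold angle $\theta$ and constant distance $d$ between consecutive vertices, but with folds alternating left underfold (at $w_1$), right overfold (at $w_2$), left underfold, and so on. The ribbon is thus wrapped around the escape accordion; each half-wrap is labelled by the vertex at which it starts. **Möbius band construction.** Construct an escape accordion with fold angle $\theta$ and distance $d$, add $2n+1$ half-wraps $w_1,\dots,w_{2n+1}$, then fold both ends of the ribbon behind the escape accordion and join them. The knot diagram is the closed polygon running from a vertex $A$ to $v_S$, along the zigzag through $v_E=w_1$ to $w_{2n+1}$, then to a vertex $E$, and back to $A$; there is a left underfold at $E$ and a left overfold at $A$, and the line $AE$ is parallel to the line through $v_S,v_E,w_{2n+1}$. *)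

(* Defs.v *)
From Stdlib Require Export Relation_Operators.
From mathcomp Require Export all_boot all_order all_algebra.
From mathcomp Require Export boolp reals trigo.

Set Implicit Arguments.
Unset Strict Implicit.
Unset Printing Implicit Defensive.

Import Order.TTheory GRing.Theory Num.Theory.
Local Open Scope ring_scope.

Notation plane R := (R^o * R^o)%type.
Notation space R := (R^o * R^o * R^o)%type.

Section Plane.
Variable R : realType.
Implicit Types p q : plane R.

Definition dot p q : R := p.1 * q.1 + p.2 * q.2.
Definition cross p q : R := p.1 * q.2 - p.2 * q.1.
Definition norm p : R := Num.sqrt (dot p p).
(* rotation by a quarter turn counterclockwise *)
Definition rot90 p : plane R := (- p.2, p.1).
End Plane.

Section PolygonalKnots.
Variables (R : realType).

Definition seg (V : lmodType R) (a b x : V) : Prop :=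
  exists t : R, [/\ 0 <= t, t <= 1 & x = (1 - t) *: a + t *: b].

Definition triangle (V : lmodType R) (a b c x : V) : Prop :=
  exists r s t : R,
    [/\ 0 <= r, 0 <= s, 0 <= t, r + s + t = 1 & x = r *: a + s *: b + t *: c].

Implicit Types P Q T : seq (space R).

(* A sequence of points is read as the closed polygon visiting them in cyclic
   order. *)
Definition corner P (k : nat) : space R := nth 0 P (k %% size P)%N.
Definition side P (k : nat) (x : space R) : Prop :=
  seg (corner P k) (corner P k.+1) x.
Definition trace P (x : space R) : Prop := exists k, side P k x.

Definition simple_polygon P : Prop :=
  [/\ (2 < size P)%N, uniq P &
      forall i j x, side P i x -> side P j x ->
        [\/ (i = j %[mod size P])%N,
            (j = i.+1 %[mod size P])%N /\ x = corner P j |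
            (i = j.+1 %[mod size P])%N /\ x = corner P i]].

(* Reidemeister's elementary move: the side ab is replaced by the sides ar and
   rb of a triangle that meets the polygon in ab only. *)
Definition delta_move P Q : Prop :=
  exists (a b r : space R) (s : seq (space R)) (k l : nat),
    [/\ rot k P = a :: b :: s, rot l Q = a :: r :: b :: s,
        simple_polygon P, simple_polygon Q &
        forall x, triangle a r b x -> trace P x -> seg a b x].

Definition knot_equiv : seq (space R) -> seq (space R) -> Prop :=
  clos_refl_sym_trans (seq (space R)) delta_move.

Definition unknotted P : Prop :=
  exists T, [/\ size T = 3%N, simple_polygon T & knot_equiv P T].

End PolygonalKnots.

(* Vertices of the knot diagram, listed along its orientation, ribbon width,
   and layering: [layer i j] says that the i-th straight strip of ribbon lies
   over the j-th one.  It carries information only if the two strips overlap;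
   strips are convex, so over/under information that is continuous on their
   overlap is constant there.  The crossing information of the diagram is the
   restriction of the layering to the core. *)
Record ribbon (R : realType) := Ribbon {
  vertices : seq (plane R);
  width : R;
  layer : rel nat }.

Section FoldedRibbons.
Variables (R : realType) (K : ribbon R).
Implicit Types (p q : plane R) (i j k : nat).

(* Indices are read modulo [nv].  Edge (or strip) k runs from vertex k to
   vertex k+1, and fold k is the one at vertex k+1, from strip k to
   strip k+1. *)
Definition nv : nat := size (vertices K).
Definition vt k : plane R := nth 0 (vertices K) (k %% nv)%N.
Definition pre k : nat := (k + nv.-1)%N.
Definition edge k : plane R := vt k.+1 - vt k.
Definition len k : R := norm (edge k).
Definition dir k : plane R := (len k)^-1 *: edge k.
Definition nrm k : plane R := rot90 (dir k).
Definition lies_over i j : bool := layer K (i %% nv)%N (j %% nv)%N.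

Definition total_len : R := \sum_(k < nv) len k.
Definition ribbonlength : R := total_len / width K.

Definition fold_angle k : R := acos (dot (- dir k) (dir k.+1)).
Definition left_fold k : Prop := 0 < cross (dir k) (dir k.+1).
Definition right_fold k : Prop := cross (dir k) (dir k.+1) < 0.
Definition overfold k : Prop := lies_over k.+1 k.
Definition underfold k : Prop := lies_over k k.+1.

(* The sum of the unit vectors leaving vertex k+1 along its two edges, that is,
   a vector along the bisector of the fold angle. *)
Definition bis k : plane R := dir k.+1 - dir k.
(* It vanishes on the fold line, and is positive on the side of that line on
   which both strips lie. *)
Definition fold_form k p : R := dot (p - vt k.+1) (bis k).

Definition fold_line k p : Prop :=
  fold_form k p = 0 /\ `|dot (p - vt k.+1) (nrm k)| <= width K / 2.
Definition open_fold_line k p : Prop :=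
  fold_form k p = 0 /\ `|dot (p - vt k.+1) (nrm k)| < width K / 2.

Definition strip k p : Prop :=
  [/\ `|dot (p - vt k) (nrm k)| <= width K / 2,
      0 <= fold_form (pre k) p & 0 <= fold_form k p].
Definition open_strip k p : Prop :=
  [/\ `|dot (p - vt k) (nrm k)| < width K / 2,
      0 < fold_form (pre k) p & 0 < fold_form k p].

Definition overlap i j : Prop :=
  (i != j %[mod nv])%N /\ exists p, open_strip i p /\ open_strip j p.

Definition polygonal : Prop := forall k, 0 < len k /\ bis k != 0.

(* The two fold lines bounding a strip are disjoint and in the right order, so
   that the ribbon has no singularities besides its fold lines. *)
Definition immersed : Prop :=
  forall k p, fold_line k p -> 0 < fold_form k.+1 p.

(* Strip j lies between the two layers joined by fold i. *)
Definition between j i : bool := lies_over j i != lies_over j i.+1.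

(* The layering is that of an embedded band pressed flat: over each point it is
   a strict linear order of the strips; a strip does not penetrate a fold whose
   fold line it crosses; and two folds on the same side of a common piece of
   fold line are nested or separated, not interleaved. *)
Definition layered : Prop :=
  [/\ forall i j, overlap i j -> lies_over i j = ~~ lies_over j i,
      forall i j k p, open_strip i p -> open_strip j p -> open_strip k p ->
        (i != j %[mod nv])%N -> (j != k %[mod nv])%N -> (i != k %[mod nv])%N ->
        lies_over i j -> lies_over j k -> lies_over i k,
      forall i j p, open_fold_line i p -> open_strip j p ->
        (j != i %[mod nv])%N -> (j != i.+1 %[mod nv])%N -> ~~ between j i &
      forall i j p q, (i != j %[mod nv])%N -> p != q ->
        open_fold_line i p -> open_fold_line i q ->
        open_fold_line j p -> open_fold_line j q ->
        0 < dot (bis i) (bis j) ->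
        between j i = between j.+1 i].

Definition folded_ribbon_knot : Prop :=
  [/\ 0 < width K, polygonal, immersed & layered].

(** Topological type *)

(* The unfolded ribbon is a flat strip with coordinates s (arclength along the
   core) and t (signed distance to the core), |t| <= width/2.  Every fold is a
   reflection, hence swaps the sides of the core in the plane. *)
Definition folded_at k (s t : R) : plane R :=
  vt k + (s - \sum_(i < k) len i) *: dir k + ((-1) ^+ k * t) *: nrm k.
Definition folded (s t : R) p : Prop :=
  exists k, p = folded_at k s t /\ strip k p.
(* The folded strip closes up by identifying (s, t) with (s + Len, -t), so the
   ribbon is the folded image of a flat Moebius band; for an annulus, (s, t)
   would be identified with (s + Len, t). *)
Definition mobius_band : Prop :=
  forall s t p, folded s t p -> folded (s + total_len) (- t) p.

(** Ribbon linking number *)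

(* The point of the line through fold line k at signed distance s from
   edge k. *)
Definition fold_point k (s : R) : plane R :=
  vt k.+1
  + (s * cross (dir k) (dir k.+1) / (1 - dot (dir k) (dir k.+1))) *: dir k
  + s *: nrm k.

(* The boundary component t = width/2, oriented as the knot: its k-th edge, from
   [bd k] to [bd k.+1], bounds strip k+1.  It closes up after nv edges in an
   annulus, and after 2 nv edges in a Moebius band. *)
Definition bd k : plane R := fold_point k ((-1) ^+ k * (width K / 2)).
Definition bd_size : nat := if odd nv then nv.*2 else nv.

(* The projections of the core and the boundary component meet only at
   interior points of edges, hence transversally. *)
Definition general_position : Prop :=
  forall i k, ~ seg (bd k) (bd k.+1) (vt i) /\ ~ seg (vt i) (vt i.+1) (bd k).

(* Sign of the crossing of edge i of the knot with edge k of the boundary. *)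
Definition crossing_sign i k : R :=
  if `[< exists p, seg (vt i) (vt i.+1) p /\ seg (bd k) (bd k.+1) p >]
  then if lies_over i k.+1 then Num.sg (cross (dir i) (dir k.+1))
                      else Num.sg (cross (dir k.+1) (dir i))
  else 0.

Definition ribbon_linking_number (l : R) : Prop :=
  general_position /\
  l = (\sum_(i < nv) \sum_(k < bd_size) crossing_sign i k) / 2.

(** Knot type *)

(* Heights of a polygonal knot in space that projects onto the diagram:
   [h k] lists pairs (tau, z), where z is the height of a vertex of the knot
   above the point of edge k with parameter tau. *)
Definition lift_points (h : nat -> seq (R * R)) k : seq (space R) :=
  [seq (vt k + u.1 *: edge k, u.2) | u <- h (k %% nv)%N].
Definition lift_arc h k : seq (space R) :=
  rcons (lift_points h k) (head 0 (lift_points h k.+1)).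
Definition on_arc h k (x : space R) : Prop :=
  exists i, (i.+1 < size (lift_arc h k))%N /\
    seg (nth 0 (lift_arc h k) i) (nth 0 (lift_arc h k) i.+1) x.
Definition lift_polygon h : seq (space R) :=
  flatten [seq lift_points h k | k <- iota 0 nv].

Definition diagram_lift h : Prop :=
  (forall k, exists (z : R) (r : seq (R * R)),
      [/\ h (k %% nv)%N = (0, z) :: r,
          path <%R 0 (map fst r) & all (fun u => u.1 < 1) r]) /\
  (forall i j x y, overlap i j -> lies_over i j ->
      on_arc h i x -> on_arc h j y -> x.1 = y.1 -> x <> y -> y.2 < x.2).

Definition unknot_diagram : Prop :=
  exists h, [/\ diagram_lift h, simple_polygon (lift_polygon h) &
                unknotted (lift_polygon h)].

Definition folded_ribbon_unknot : Prop :=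
  folded_ribbon_knot /\ unknot_diagram.

(** Accordions, half-wraps, and the Moebius band construction *)

(* c folds of angle theta at vertices 1, ..., c, starting with a left one. *)
Definition accordion (theta d : R) (c : nat) : Prop :=
  (forall i, (i < c)%N ->
     [/\ fold_angle i = theta,
         if odd i then right_fold i else left_fold i & overfold i]) /\
  (forall i, (0 < i < c)%N -> len i = d).

(* The start vertex is vertex 1, the end vertex is vertex 2m+1; strips 0 and 2m
   are the parallel pieces entering and leaving the accordion, whose distance is
   that of their core lines: at distance 1 pieces of width 1 become adjacent. *)
Definition escape_accordion (theta d : R) (m : nat) : Prop :=
  [/\ accordion theta d m.*2, len m.*2 = d &
      1 <= `|dot (vt m.*2.+1 - vt 1) (nrm 0)|].

(* c half-wraps following the escape accordion; half-wrap w_(i+1) starts at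
   vertex 2m+1+i and is the strip with that index.  The ribbon is wrapped around
   the accordion: its half-wraps pass alternately behind and in front of the
   strips of the accordion. *)
Definition half_wraps (theta d : R) (m c : nat) : Prop :=
  [/\ forall i, (i < c)%N ->
        fold_angle (m.*2 + i) = theta /\
        if odd i then right_fold (m.*2 + i) /\ overfold (m.*2 + i)
                 else left_fold (m.*2 + i) /\ underfold (m.*2 + i),
      forall i, (i.+1 < c)%N -> len (m.*2.+1 + i) = d &
      forall i j, (i < c)%N -> (0 < j <= m.*2)%N ->
        overlap (m.*2.+1 + i) j ->
        if odd i then lies_over (m.*2.+1 + i) j else lies_over j (m.*2.+1 + i)].

(* Vertex 0 is A, vertices 1, ..., 2m+2n+1 form the zigzag of the escape
   accordion and the 2n+1 half-wraps, and vertex 2m+2n+2 is E.  The strip EA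
   is behind the escape accordion. *)
Definition mobius_construction (theta d : R) (m n : nat) : Prop :=
  let w := (m.*2 + n.*2).+1 in
  [/\ nv = w.+2, escape_accordion theta d m, half_wraps theta d m n.*2.+1,
      (left_fold w /\ underfold w) /\ (left_fold w.+1 /\ overfold w.+1) &
      cross (vt w - vt 1) (edge w.+1) = 0 /\
      forall j, (j <= m.*2)%N -> overlap w.+1 j -> lies_over j w.+1].

End FoldedRibbons.

(* Main.v *)
Require Import Defs.
From mathcomp Require Import ring lra zify.
Set Implicit Arguments.
Unset Strict Implicit.
Unset Printing Implicit Defensive.
Import Order.TTheory GRing.Theory Num.Theory.
Local Open Scope ring_scope.

(** The band can be written down. Take the line through the start and end
vertices of the zigzag as horizontal. All fold angles being pi/3, every strip
has slope 0 or plus or minus the square root of 3; with 1/(m sqrt 3) as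
horizontal and 1/m as vertical unit the slopes become 0 and plus or minus 1, and
the zigzag has integer vertices: its height alternates between 0 and 1 while its
abscissa grows by 1 along each edge. In these units a slanted strip of width 1
meets every horizontal line in a segment of half-length m. Hence 2m folds move
the ribbon by exactly its width, and they form an escape accordion. The 2n+1
half-wraps continue the zigzag, two legs of height L lead from its ends up to A
and E, and AE closes a trapezoid. The ribbon is immersed as soon as L exceeds
m/2, and the total length is 6(m + n + L)/(m sqrt 3) ([band_total_len]). For L =
m/2 and n negligible against m this is 3 sqrt 3; so for a large m the L that
makes the length exactly 3 sqrt 3 + eps exceeds m/2, and even m/2 + 1, which
keeps EA above the zigzag.

The layering is a linear order of the strips: the strip EA lowest, then the odd
half-wraps from the last to the first, then the entering strip and the accordion
in their order along the ribbon, then the even half-wraps. Every fold of the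
accordion joins neighbours in this order, and every later fold of the zigzag
encloses all earlier strips ([rank_between]), so folds on a common line are
nested or separated. Of the three strips that leave the zigzag, EA stays above
its height and the last half-wrap is beneath all of it; only the entering strip
could be caught in the fold between two half-wraps, and they avoid it because
the ribbon has moved by its full width before. This is what the escape accordion
is for ([band_layered]).

The diagram without AE is the graph of a function of the abscissa lying below
the height of AE ([garland]). It has no crossings, and cutting off its vertices
one after the other unknots it ([garland_unknotted]).

Therefore only crossings between the core and the boundary count. Inside the
zigzag the boundary is the core shifted by plus or minus m, and m is odd: parity
gives general position, and shows that edge i of the core crosses a side of
strip j exactly when i and j differ by m ([rail_cross]). The sign depends only
on the larger of the two indices ([over_sign_zigzag]): for the indices m, ...,
2m it alternates and cancels, while each of the 2n+1 half-wraps contributes 1.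
The crossings at A and at E cancel each other ([over_sign_start],
[over_sign_end]). Every pair of strips is counted twice, once for each of them
being represented by its core, and half of the total is 2n+1 ([band_linking]).
*)

(** * Polygons hanging from a horizontal edge *)

Section Garland.
Variables (R : realType) (H : R).
Implicit Types P : seq (space R).

(** A chain with increasing abscissas that hangs down between its two ends, which
the closing side joins. *)
Definition garland P : Prop :=
  [/\ (2 < size P)%N,
      forall i j, (i < j < size P)%N -> (nth 0 P i).1.1 < (nth 0 P j).1.1,
      forall i, i = 0%N \/ i = (size P).-1 -> (nth 0 P i).1.2 = H &
      forall i, (0 < i < (size P).-1)%N -> (nth 0 P i).1.2 < H].

Lemma seg_coord (a b x : space R) : seg a b x ->
  exists t : R, [/\ 0 <= t <= 1, x = (1 - t) *: a + t *: b,
    x.1.1 = (1 - t) * a.1.1 + t * b.1.1 &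
    x.1.2 = (1 - t) * a.1.2 + t * b.1.2].
Proof. by case=> t [t0 t1 ->]; exists t; rewrite t0 t1; split. Qed.

Lemma seg_fst (a b x : space R) : seg a b x -> a.1.1 < b.1.1 ->
  a.1.1 <= x.1.1 <= b.1.1 /\
  ((x.1.1 = a.1.1 -> x = a) /\ (x.1.1 = b.1.1 -> x = b)).
Proof.
case/seg_coord=> t [/andP[t0 t1] xE x1 _]; rewrite x1 xE.
set a1 : R := a.1.1; set b1 : R := b.1.1 => ab.
split; first by apply/andP; split; nra.
split=> e.
  have -> : t = 0 by nra.
  by rewrite subr0 scale1r scale0r addr0.
have -> : t = 1 by nra.
by rewrite subrr scale0r scale1r add0r.
Qed.

Lemma seg_snd (a b x : space R) : seg a b x ->
  a.1.2 <= H -> b.1.2 <= H -> x.1.2 = H ->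
  (a.1.2 < H -> x = b) /\ (b.1.2 < H -> x = a).
Proof.
case/seg_coord=> t [/andP[t0 t1] xE _ x2]; rewrite x2 xE.
set a1 : R := a.1.2; set b1 : R := b.1.2 => aH bH e.
split=> lt.
  have -> : t = 1 by nra.
  by rewrite subrr scale0r scale1r add0r.
have -> : t = 0 by nra.
by rewrite subr0 scale1r scale0r addr0.
Qed.

Lemma garland_side P k x : garland P -> side P k x ->
  (k %% size P)%N = (size P).-1 /\ x.1.2 = H \/
  ((k %% size P).+1 < size P)%N /\
  seg (nth 0 P (k %% size P)) (nth 0 P (k %% size P).+1) x.
Proof.
case=> szP incP endP midP; rewrite /side /corner.
have sz0 : (0 < size P)%N by lia.
have := ltn_pmod k sz0.
have -> : (k.+1 %% size P)%N = ((k %% size P).+1 %% size P)%N.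
  by rewrite -addn1 -modnDml addn1.
set r := (k %% size P)%N => rP xk.
have [/eqP rE|rE] := boolP (r == (size P).-1); last first.
  have rP' : (r.+1 < size P)%N by lia.
  by right; rewrite modn_small in xk.
left; split=> //; move: xk.
have -> : (r.+1 %% size P)%N = 0%N by rewrite rE prednK // modnn.
case/seg_coord=> t [_ _ _ ->].
rewrite (endP r) ?(endP 0%N) //; [ring|by left|by right].
Qed.

Lemma garland_le P i : garland P -> (i < size P)%N -> (nth 0 P i).1.2 <= H.
Proof.
case=> szP _ endP midP iP.
have [i0|i0] := boolP ((i == 0%N) || (i == (size P).-1)).
  by rewrite endP //; case/orP: i0 => /eqP; [left|right].
by apply/ltW/midP; lia.
Qed.

(** Sides of the chain are separated by their abscissas, and the chain meets the
height H of the closing side at its two ends only. *)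
Lemma garland_simple P : garland P -> simple_polygon P.
Proof.
move=> gP; case: (gP) => szP incP endP midP.
have sz0 : (0 < size P)%N by lia.
have chain i j x : ((i %% size P).+1 < size P)%N ->
    ((j %% size P).+1 < size P)%N -> (i %% size P < j %% size P)%N ->
    seg (nth 0 P (i %% size P)) (nth 0 P (i %% size P).+1) x ->
    seg (nth 0 P (j %% size P)) (nth 0 P (j %% size P).+1) x ->
    (j = i.+1 %[mod size P])%N /\ x = corner P j.
  rewrite /corner -(addn1 i) -(modnDml i) addn1.
  move: (i %% _)%N (j %% _)%N => r s rP sP rs xr xs.
  have [/andP[_ xr1] _] := seg_fst xr (incP r r.+1 ltac:(lia)).
  have [/andP[xs1 _] [xsE _]] := seg_fst xs (incP s s.+1 ltac:(lia)).
  have rsE : s = r.+1.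
    apply/eqP; rewrite eqn_leq rs andbT leqNgt; apply/negP => lt.
    by have := incP r.+1 s ltac:(lia); lra.
  subst s; rewrite modn_small //; split=> //; apply: xsE; lra.
have top i j x : ((i %% size P).+1 < size P)%N ->
    (j %% size P)%N = (size P).-1 -> x.1.2 = H ->
    seg (nth 0 P (i %% size P)) (nth 0 P (i %% size P).+1) x ->
    (j = i.+1 %[mod size P])%N /\ x = corner P j \/
    (i = j.+1 %[mod size P])%N /\ x = corner P i.
  rewrite /corner -(addn1 i) -(modnDml i) -(addn1 j) -(modnDml j) !addn1.
  move: (i %% _)%N (j %% _)%N => r s rP -> xH xr.
  have rH : (nth 0 P r).1.2 <= H by apply: garland_le => //; lia.
  have [x1 x2] := seg_snd xr rH (garland_le gP rP) xH.
  rewrite prednK // modnn.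
  have [/eqP r0|r0] := boolP (r == 0%N).
    by right; split=> //; apply: x2; apply: midP; lia.
  have x1E : x = nth 0 P r.+1 by apply/x1/midP; lia.
  left; have rE : r.+1 = (size P).-1.
    have [//|ne] := eqVneq r.+1 (size P).-1.
    by have := midP r.+1 ltac:(lia); rewrite -x1E xH ltxx.
  by rewrite -rE modn_small.
split=> //.
  apply/(uniqP 0) => i j iP jP e.
  have {}iP : (i < size P)%N := iP.
  have {}jP : (j < size P)%N := jP.
  have [lt|lt|//] := ltngtP i j.
    by have := incP i j ltac:(lia); rewrite e ltxx.
  by have := incP j i ltac:(lia); rewrite e ltxx.
move=> i j x /(garland_side gP) xi /(garland_side gP) xj.
case: xi => [[iE xH]|[iP xi]]; case: xj => [[jE xH']|[jP xj]].
- by apply: Or31; rewrite iE jE.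
- have [[e1 e2]|[e1 e2]] := top j i x jP iE xH xj; first by apply: Or33.
  by apply: Or32.
- have [[e1 e2]|[e1 e2]] := top i j x iP jE xH' xi.
    by apply: Or32.
  by apply: Or33.
- have [lt|lt|e] := ltngtP (i %% size P)%N (j %% size P)%N; last by apply: Or31.
    by apply: Or32; apply: chain iP jP lt xi xj.
  by apply: Or33; apply: chain jP iP lt xj xi.
Qed.

Lemma garland_behead a r b c s :
  garland [:: a, r, b, c & s] -> garland [:: a, b, c & s].
Proof.
case=> szP incP endP midP; split=> //.
- move=> [|i] [|j] // ij.
    by apply: (incP 0%N j.+2).
  by apply: (incP i.+2 j.+2).
- move=> [|i] [] // ei; first by apply: (endP 0%N); left.
  by apply: (endP i.+2); right; move: ei => /= ei; lia.
- by move=> [|i] // ij; apply: (midP i.+2).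
Qed.

(** The triangle cut off at the second vertex lies to the left of the rest of
the chain, and reaches the height of the closing side only at the first vertex.
*)
Lemma garland_move a r b c s : garland [:: a, r, b, c & s] ->
  delta_move [:: a, b, c & s] [:: a, r, b, c & s].
Proof.
move=> gQ; have gP := garland_behead gQ.
exists a, b, r, (c :: s), 0%N, 0%N; rewrite !rot0; split=> //.
- exact: garland_simple gP.
- exact: garland_simple gQ.
case: (gQ) => _ incQ endQ midQ.
have aH : a.1.2 = H by apply: (endQ 0%N); left.
have rH : r.1.2 < H by apply: (midQ 1%N).
have bH : b.1.2 < H by apply: (midQ 2%N).
have ar : a.1.1 < r.1.1 by apply: (incQ 0%N 1%N).
have rb : r.1.1 < b.1.1 by apply: (incQ 1%N 2%N).
move=> x [t1 [t2 [t3 [t10 t20 t30 t123 xE]]]] [k /(garland_side gP)].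
have x1 : x.1.1 = t1 * a.1.1 + t2 * r.1.1 + t3 * b.1.1 by rewrite xE.
have x2 : x.1.2 = t1 * a.1.2 + t2 * r.1.2 + t3 * b.1.2 by rewrite xE.
set P := [:: a, b, c & s] in gP *.
case=> [[_ xH]|[]].
  have t2E : t2 = 0 by nra.
  have t3E : t3 = 0 by nra.
  have t1E : t1 = 1 by lra.
  by exists 0; split=> //; rewrite xE t1E t2E t3E subr0 !scale0r !addr0.
case: (k %% _)%N => [//|i] iP xi.
have i3 : (i.+2 < i.+3 < size [:: a, r, b, c & s])%N by rewrite ltnSn.
have [/andP[lo _] _] := seg_fst xi (incQ i.+2 i.+3 i3).
have bi : b.1.1 <= (nth 0 P i.+1).1.1.
  case: i iP {xi lo i3} => [//|i] iP.
  by apply/ltW/(incQ 2%N i.+3); move: iP => /=; lia.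
have t1E : t1 = 0 by nra.
have t2E : t2 = 0 by nra.
have t3E : t3 = 1 by lra.
exists 1; split=> //.
by rewrite xE t1E t2E t3E subrr !scale0r !add0r.
Qed.

Lemma garland_unknotted P : garland P -> unknotted P.
Proof.
have [k] := ubnP (size P); elim: k P => // k IH P szk gP.
have [szP _ _ _] := gP.
case: P szk gP szP => [|a [|r [|b s]]] // szk gP _.
case: s szk gP => [|c s] szk gP.
  exists [:: a; r; b]; split=> //; first exact: garland_simple gP.
  exact: rst_refl.
have [|T [szT simT eqT]] := IH _ _ (garland_behead gP); first by move: szk.
exists T; split=> //; apply: rst_trans eqT.
exact/rst_sym/rst_step/garland_move.
Qed.

End Garland.

(** * The band *)

Section Band.
Variables (R : realType) (m n : nat) (L : R).
Hypotheses (m_odd : odd m) (L_big : m%:R / 2 + 1 < L).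

(* Strip w is the last half-wrap, which ends at E, and strip w+1 is EA. *)
Notation w := (m.*2 + n.*2).+1.
Notation res k := (k %% w.+2)%N.
Notation M := (m%:R : R).
Notation T := ((m.*2 + n.*2)%:R : R).
Notation s3 := (Num.sqrt 3 : R).

(** The units for which the zigzag has integer vertices and slopes 1 and -1. *)
Definition pt (X Y : R) : plane R := (X / (M * s3), Y / M).
Definition xc (p : plane R) : R := M * s3 * p.1.
Definition yc (p : plane R) : R := M * p.2.

Definition vertex_x k : R :=
  if k == 0%N then - L else if (k <= w)%N then k.-1%:R else T + L.
Definition vertex_y k : R := if (0 < k <= w)%N then (odd k.-1)%:R else L.
Definition vertex k : plane R := pt (vertex_x k) (vertex_y k).

(** Height of the layers. The strips 0, ..., 2m keep their order; then even
strips are put on top of, and odd strips below, everything before them, and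
strip w+1 comes last, below everything. *)
Definition rank k : nat :=
  if (k <= m.*2)%N || ~~ odd k && (k < w)%N then (w.+2 + k)%N else (w.+2 - k)%N.

Definition band : ribbon R :=
  Ribbon (mkseq vertex w.+2) 1 (fun i j => rank j < rank i)%N.
Notation K := band.

Definition next k : nat := if k == w.+1 then 0%N else k.+1.

Lemma s3_gt0 : 0 < s3. Proof. by rewrite sqrtr_gt0. Qed.
Lemma s3_sqr : s3 * s3 = 3. Proof. by rewrite -expr2 sqr_sqrtr. Qed.
Lemma M_gt0 : 0 < M. Proof. by rewrite ltr0n; case: m m_odd. Qed.
Lemma L_gt1 : 1 < L.
Proof. by have := M_gt0; have := L_big; lra. Qed.

Lemma nv_band : nv K = w.+2. Proof. by rewrite /nv size_mkseq. Qed.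

Lemma vt_band k : vt K k = vertex (res k).
Proof. by rewrite /vt nv_band nth_mkseq // ltn_pmod. Qed.

Lemma next_mod k : res k.+1 = next (res k).
Proof.
rewrite -addn1 -modnDml addn1 /next.
have := ltn_pmod k (ltn0Sn w.+1).
case: eqP => [->|ne] lt; first by rewrite modnn.
by rewrite modn_small //; move: ne lt; lia.
Qed.

Definition reach k : R := if (k == 0%N) || (k == w) then L else 1.

Definition edge_len k : R :=
  (if k == w.+1 then T + 2 * L else 2 * reach k) / (M * s3).
Definition edge_dir k : plane R :=
  if k == w.+1 then (-1, 0) else (2^-1, if odd k then s3 / 2 else - (s3 / 2)).

Lemma edge_len_gt0 k : 0 < edge_len k.
Proof.
have := L_gt1 => L1.
apply: divr_gt0; last by rewrite mulr_gt0 ?M_gt0 ?s3_gt0.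
rewrite /reach; case: ifP => _; first by have := ler0n R (m.*2 + n.*2); lra.
by case: ifP; lra.
Qed.

Lemma pt_sub X Y X' Y' :
  pt X Y - pt X' Y' = ((X - X') / (M * s3), (Y - Y') / M).
Proof. by rewrite !mulrBl. Qed.

Lemma pt_eq X Y c (d : plane R) :
  X = c * d.1 * (M * s3) -> Y = c * d.2 * M -> pt X Y = c *: d.
Proof.
move=> -> ->; case: d => d1 d2; rewrite /pt /=.
have M0 := lt0r_neq0 M_gt0; have s0 := lt0r_neq0 s3_gt0.
by rewrite !mulfK // mulf_neq0.
Qed.

Lemma edge_vertex k : (k < w.+2)%N ->
  vertex (next k) - vertex k = edge_len k *: edge_dir k.
Proof.
move=> kw; rewrite pt_sub -/(pt _ _).
have M0 := lt0r_neq0 M_gt0; have s0 := lt0r_neq0 s3_gt0.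
have ss := s3_sqr.
rewrite /edge_len /edge_dir /next; case: eqVneq => [->|kn].
  apply: pt_eq; rewrite /vertex_x /vertex_y /= ?ltnn;
    last by rewrite mulr0 mul0r subrr.
  by field; rewrite ?M0 ?s0.
have [->|k0] := eqVneq k 0%N.
  apply: pt_eq; rewrite /vertex_x /vertex_y /reach /=; first by field;
    rewrite ?M0 ?s0.
  by field; rewrite ?M0 ?s0.
have [->|kw1] := eqVneq k w.
  rewrite /vertex_x /vertex_y /reach /= eqxx ltnn leqnn !oddD !odd_double /=.
  by apply: pt_eq => /=; field; rewrite ?M0 ?s0.
have kw2 : (k < w)%N by lia.
rewrite /vertex_x /vertex_y /reach (negPf k0) (negPf kw1) /= kw2 (ltnW kw2).
case: k k0 kw kn kw1 kw2 => // k _ _ _ _ _; rewrite /=.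
apply: pt_eq => /=; first by rewrite -natr1; field; rewrite ?M0 ?s0.
by case: (odd k) => /=; field; rewrite ?M0 ?s0.
Qed.

Lemma norm_scale_edge_dir c k : 0 < c -> norm (c *: edge_dir k) = c.
Proof.
move=> c0; have ss := s3_sqr.
have -> : norm (c *: edge_dir k) = Num.sqrt (c ^+ 2).
  congr Num.sqrt; rewrite /dot /edge_dir; case: ifP => _ /=.
    by rewrite /GRing.scale /=; ring.
  rewrite /GRing.scale /=; case: ifP => _.
    have -> : c * 2^-1 * (c * 2^-1) + c * (s3 / 2) * (c * (s3 / 2)) =
      c ^+ 2 * (1 + s3 * s3) / 4 by field.
    by rewrite ss; field.
  have -> : c * 2^-1 * (c * 2^-1) + c * - (s3 / 2) * (c * - (s3 / 2)) =
      c ^+ 2 * (1 + s3 * s3) / 4 by field.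
  by rewrite ss; field.
by rewrite sqrtr_sqr gtr0_norm.
Qed.

Lemma edge_band k : edge K k = edge_len (res k) *: edge_dir (res k).
Proof. by rewrite /edge !vt_band next_mod edge_vertex // ltn_pmod. Qed.

Lemma len_band k : len K k = edge_len (res k).
Proof. by rewrite /len edge_band norm_scale_edge_dir // edge_len_gt0. Qed.

Lemma dir_band k : dir K k = edge_dir (res k).
Proof.
rewrite /dir len_band edge_band scalerA mulVf ?scale1r //.
exact/lt0r_neq0/edge_len_gt0.
Qed.

(** * Strips and fold lines in coordinates *)

Definition prev k : nat := if k == 0%N then w.+1 else k.-1.

Lemma pre_mod k : res (pre K k) = prev (res k).
Proof.
rewrite /pre nv_band /prev -modnDml /=.
have := ltn_pmod k (ltn0Sn w.+1); case: eqP => [->|ne] lt.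
  by rewrite add0n modn_small.
have -> : (res k + w.+1 = (res k).-1 + w.+2)%N by move: ne lt; lia.
by rewrite modnDr modn_small //; move: ne lt; lia.
Qed.

(** Up to a positive factor, the equation of the fold line k: heights 0 and 1
alternate in the zigzag, and the two remaining lines pass through E and A. *)
Definition mirror_form k (X Y : R) : R :=
  if k == w.+1 then (X - Y + 2 * L) / 2
  else if k == w then (T + 2 * L - X - Y) / 2
  else if odd k then 1 - Y else Y.

(** The signed distance to the core of strip k, in units of 1/(2m), so that the
strip is given by values between -m and m. *)
Definition offset k (X Y : R) : R :=
  if k == w.+1 then 2 * (L - Y)
  else if odd k then Y - X + k.-1%:R else X + Y - k%:R.

Lemma odd_w : odd w. Proof. by rewrite /= oddD !odd_double. Qed.

Lemma bis_band k : bis K k = edge_dir (next (res k)) - edge_dir (res k).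
Proof. by rewrite /bis !dir_band next_mod. Qed.

Lemma edge_dir_turn k : (k < w.+2)%N -> edge_dir (next k) - edge_dir k =
  if k == w.+1 then (3 / 2, - (s3 / 2))
  else if k == w then (- (3 / 2), - (s3 / 2))
  else if odd k then (0, - s3) else (0, s3).
Proof.
move=> kw; have ow := odd_w; rewrite /next.
have pairE (a b c d e f : R) : a - c = e -> b - d = f ->
    (a, b) - (c, d) = (e, f) :> plane R by move=> <- <-.
case: eqVneq => [->|k1].
  by rewrite /edge_dir eqxx /=; apply: pairE; field.
case: eqVneq => [->|k2].
  rewrite /edge_dir eqxx ow (ltn_eqF (ltnSn w)).
  by apply: pairE; field.
rewrite /edge_dir eqSS (negPf k2) (negPf k1) /=.
by case: (odd k) => /=; apply: pairE; field.
Qed.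

(** The factor sqrt 3 in the second vector clears the horizontal unit, so that
square roots disappear from all equations of lines. *)
Lemma dot_pt p a b c d : dot (p - pt a b) (c * s3, d) =
  ((xc p - a) * c + (yc p - b) * d) / M.
Proof.
have M0 := lt0r_neq0 M_gt0; have s0 := lt0r_neq0 s3_gt0.
case: p => x y; rewrite /dot /pt /xc /yc /=.
by field; rewrite ?M0 ?s0.
Qed.

Lemma fold_form_band k p :
  fold_form K k p = s3 / M * mirror_form (res k) (xc p) (yc p).
Proof.
rewrite /fold_form bis_band vt_band next_mod.
have := ltn_pmod k (ltn0Sn w.+1); set r := res k => rw.
have ss := s3_sqr; have ow := odd_w; have M0 := lt0r_neq0 M_gt0.
have s32 : 3 / 2 = s3 / 2 * s3 by rewrite mulrAC ss.
rewrite edge_dir_turn // /vertex /mirror_form /next.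
case: (eqVneq r w.+1) => [_|k1].
  by rewrite s32 dot_pt /vertex_x /vertex_y /=; field; rewrite ?M0.
case: (eqVneq r w) => [->|k2].
  rewrite s32 -mulNr dot_pt /vertex_x /vertex_y ltnn /=.
  by field; rewrite ?M0.
have rw' : (r < w)%N by move: k1 k2 rw; lia.
rewrite /vertex_x /vertex_y /= rw'.
by case: (odd r); rewrite -[in X in dot _ X](mul0r s3) dot_pt /=; field;
  rewrite ?M0.
Qed.

Lemma nrm_band k : nrm K k =
  if res k == w.+1 then (0 * s3, -1)
  else if odd (res k) then (- (1 / 2) * s3, 1 / 2) else (1 / 2 * s3, 1 / 2).
Proof.
rewrite /nrm dir_band /rot90 /edge_dir; case: ifP => _ /=;
  first by rewrite oppr0 mul0r.
by case: (odd _); congr pair; field.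
Qed.

Lemma offset_band k p :
  dot (p - vt K k) (nrm K k) = offset (res k) (xc p) (yc p) / (2 * M).
Proof.
rewrite nrm_band vt_band /offset /vertex.
have := ltn_pmod k (ltn0Sn w.+1); set r := res k => rw.
have M0 := lt0r_neq0 M_gt0.
case: (eqVneq r w.+1) => [->|k1].
  by rewrite dot_pt /vertex_x /vertex_y /= ltnn; field; rewrite ?M0.
have rw' : (r <= w)%N by move: k1 rw; lia.
rewrite /vertex_x /vertex_y rw' andbT; case: r rw rw' {k1} => [|r] rw rw'.
  by rewrite dot_pt /=; field; rewrite ?M0.
rewrite /= -natr1; case: (odd r); rewrite dot_pt /=; field; rewrite ?M0 //.
Qed.

Lemma offset_next k p : dot (p - vt K k.+1) (nrm K k) = dot (p - vt K k) (nrm K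
  k).
Proof.
have -> : vt K k.+1 = vt K k + len K k *: dir K k.
  by rewrite len_band dir_band -edge_band /edge addrC subrK.
rewrite /nrm /rot90 /dot; case: p => x y; case: (vt K k) => a b.
case: (dir K k) => c d; rewrite /= /GRing.scale /=; ring.
Qed.

Lemma le_offset k p : `|offset k (xc p) (yc p) / (2 * M)| <= 2^-1 <->
  - M <= offset k (xc p) (yc p) <= M.
Proof.
have M2 : 0 < 2 * M by have := M_gt0; lra.
rewrite normrM normfV (gtr0_norm M2) ler_pdivrMr // mulKf ?ler_norml ?pnatr_eq0
  //; split.
Qed.

Lemma lt_offset k p : `|offset k (xc p) (yc p) / (2 * M)| < 2^-1 <->
  - M < offset k (xc p) (yc p) < M.
Proof.
have M2 : 0 < 2 * M by have := M_gt0; lra.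
rewrite normrM normfV (gtr0_norm M2) ltr_pdivrMr // mulKf ?ltr_norml ?pnatr_eq0
  //; split.
Qed.

Lemma sM_gt0 : 0 < s3 / M. Proof. by rewrite divr_gt0 ?s3_gt0 ?M_gt0. Qed.

Lemma fold_line_band k p : fold_line K k p ->
  mirror_form (res k) (xc p) (yc p) = 0 /\ - M <= offset (res k) (xc p) (yc p)
    <= M.
Proof.
case=> /eqP; rewrite fold_form_band mulf_eq0 (gt_eqF sM_gt0) /= => /eqP ->.
by rewrite offset_next offset_band mul1r => /le_offset.
Qed.

Lemma open_strip_band k p : open_strip K k p ->
  [/\ - M < offset (res k) (xc p) (yc p) < M,
      0 < mirror_form (prev (res k)) (xc p) (yc p) & 0 < mirror_form (res k)
        (xc p) (yc p)].
Proof.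
case; rewrite !fold_form_band !(pmulr_rgt0 _ sM_gt0) pre_mod offset_band mul1r.
by move=> /lt_offset.
Qed.

Lemma T_ge : 2 * M <= T :> R.
Proof. by rewrite -natrM ler_nat -addnn /= mul2n; lia. Qed.

Lemma natr_w : w%:R = T + 1 :> R. Proof. by rewrite natr1. Qed.

(** The parts of the position of an open strip that the layering depends on.
Entering and leaving strips are disjoint because T is at least 2m. *)
Variant strip_region k (X Y : R) : Prop :=
| EnteringRegion of k = 0%N & 0 < Y & X < M - Y
| ZigzagRegion of (0 < k < w)%N & 0 < Y < 1
| LeavingRegion of k = w & 0 < Y & T - M + Y < X
| ClosingRegion of k = w.+1 & 1 < Y.

Lemma strip_regionP k p : open_strip K k p ->
  strip_region (res k) (xc p) (yc p).
Proof.
case/open_strip_band; have := ltn_pmod k (ltn0Sn w.+1).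
move: (res k) (xc p) (yc p) => r X Y rw o f1 f2.
have ow := odd_w; have M0 := M_gt0; have LM := L_big.
move: o f1 f2; rewrite /offset /mirror_form /prev.
case: (eqVneq r w.+1) => [rE|r1].
  by move=> o _ _; apply: ClosingRegion => //; lra.
case: (eqVneq r 0%N) => [->|r0] /=.
  by move=> o _ f; apply: EnteringRegion => //; lra.
have -> : (r.-1 == w.+1) = false by move: rw; clear; lia.
have -> : (r.-1 == w) = false by move: rw r1; clear; lia.
have or1 : odd r.-1 = ~~ odd r by case: r r0 {rw r1} => //= r _; rewrite negbK.
case: (eqVneq r w) => [rE|r2].
  rewrite or1 rE ow /= => o f _; apply: LeavingRegion => //; lra.
have rz : (0 < r < w)%N by move: rw r0 r1 r2; clear; lia.
rewrite or1; case: (odd r) => /= o f1 f2; apply: ZigzagRegion => //; lra.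
Qed.

(** Likewise for fold lines. Those of the zigzag are at height 0 or 1, those at
A and E are higher, and the latter two are on different sides of the zigzag. *)
Variant fold_region k (X Y : R) : Prop :=
| ZigzagFold of (k < w)%N & Y = (odd k)%:R & k%:R - M <= X <= k%:R + M
| EndFold of k = w & 1 < Y & T < X & T - M <= X - Y
| StartFold of k = w.+1 & 1 < Y & X < 0.

Lemma fold_regionP k p : fold_line K k p ->
  fold_region (res k) (xc p) (yc p).
Proof.
case/fold_line_band; have := ltn_pmod k (ltn0Sn w.+1).
move: (res k) (xc p) (yc p) => r X Y rw.
have ow := odd_w; have M0 := M_gt0; have LM := L_big.
rewrite /offset /mirror_form; case: (eqVneq r w.+1) => [rE|r1].
  by move=> f o; apply: StartFold => //; lra.
case: (eqVneq r w) => [rE|r2].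
  by rewrite rE ow /= => f o; apply: EndFold => //; lra.
have {}rw : (r < w)%N by move: rw r1 r2; clear; lia.
case: r rw {r1 r2} => [|r] rw /=.
  by move=> f o; apply: ZigzagFold => //; rewrite ?mulr0n; lra.
case ro: (odd r) => /= f o; apply: ZigzagFold => //=;
  rewrite ?ro ?mulr0n ?mulr1n //=;
  rewrite -?(natr1 r) in o *; lra.
Qed.

Lemma open_fold_lineW k p : open_fold_line K k p -> fold_line K k p.
Proof. by case=> f /ltW. Qed.

(** * Immersion and layering *)

Lemma band_polygonal : polygonal K.
Proof.
move=> k; rewrite len_band edge_len_gt0 bis_band; split=> //.
rewrite edge_dir_turn ?ltn_pmod //; have s0 := s3_gt0.
by case: ifP => _; [|case: ifP => _; [|case: ifP => _]];
  apply/eqP => -[]; lra.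
Qed.

(** For a trapezoidal strip the bound L > m/2 separates its two fold lines. *)
Lemma band_immersed : immersed K.
Proof.
move=> k p fp; have := fold_regionP fp; have {fp} [f o] := fold_line_band fp.
rewrite fold_form_band pmulr_rgt0 ?sM_gt0 // next_mod.
move: (res k) (xc p) (yc p) f o => r X Y f o.
have ow := odd_w; have M0 := M_gt0; have LM := L_big.
have wM := T_ge; have wE := natr_w.
case=> [rw YE XE|rE Y1 XT XY|rE Y1 X0]; last 2 first.
- by rewrite rE /next /mirror_form (ltn_eqF (ltnSn w)) eqxx; lra.
- by rewrite rE /next eqxx /mirror_form /=; lra.
have rle : r.+1%:R <= w%:R :> R by rewrite ler_nat.
rewrite -(natr1 r) in rle.
rewrite /next (ltn_eqF (leqW rw)) /mirror_form eqSS (ltn_eqF rw) YE.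
case: (eqVneq r.+1 w) => [rE|r3].
  have -> : odd r = false by move: ow; rewrite -rE /= => /negPf.
  by rewrite mulr0n; lra.
by rewrite /=; case: (odd r); rewrite ?mulr0n ?mulr1n /=; lra.
Qed.

Lemma lies_over_band i j : lies_over K i j = (rank (res j) < rank (res i))%N.
Proof. by rewrite /lies_over nv_band. Qed.

Lemma rank_inj i j : (i < w.+2)%N -> (j < w.+2)%N -> rank i = rank j -> i = j.
Proof. by rewrite /rank => iw jw; do 2!case: ifP => _; lia. Qed.

Lemma rank_low k : (k < w)%N -> (rank w < rank k)%N.
Proof. by move=> kw; rewrite /rank; do 2!case: ifP => ?; lia. Qed.

Lemma rank_front k : (k <= m.*2)%N || ~~ odd k && (k < w)%N ->
  rank k = (w.+2 + k)%N.
Proof. by rewrite /rank => ->. Qed.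

Lemma rank_back k : (m.*2 < k)%N -> odd k || (w <= k)%N ->
  rank k = (w.+2 - k)%N.
Proof. by rewrite /rank => h1 h2; case: ifP => //; lia. Qed.

(** A fold of the accordion joins consecutive layers. A fold with i >= 2m joins
the bottom and the top of all strips made so far, hence encloses precisely the
earlier ones. *)
Lemma rank_between i j : (i < w)%N -> (j <= w)%N -> j != i -> j != i.+1 ->
  ((rank i < rank j) != (rank i.+1 < rank j))%N = (m.*2 <= i)%N && (j < i)%N.
Proof.
move=> iw jw ji ji1.
have Rj : rank j = (w.+2 + j)%N \/ (m.*2 < j)%N /\ rank j = (w.+2 - j)%N.
  by rewrite /rank; case: ifP => ?; [left|right; split; lia].
case: (ltnP i m.*2) => im /=.
  rewrite (@rank_front i) ?(@rank_front i.+1); [|lia|lia].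
  case: Rj => [|[jm]] ->; lia.
case oi: (odd i).
  have im' : (m.*2 < i)%N.
    by rewrite ltn_neqAle im andbT; apply/eqP => e; move: oi;
      rewrite -e odd_double.
  have iw' : (i.+1 < w)%N.
    rewrite ltn_neqAle iw andbT; apply/eqP => e; have := odd_w.
    by rewrite -e /= oi.
  rewrite (@rank_back i) ?oi // (@rank_front i.+1);
    last by rewrite /= oi iw' orbT.
  case: Rj => [|[jm]] ->; lia.
rewrite (@rank_front i); last by rewrite oi iw orbT.
rewrite (@rank_back i.+1); [|lia|by rewrite /= oi].
case: Rj => [|[jm]] ->; lia.
Qed.

Lemma rank_leaving : rank w = 2%N.
Proof. by rewrite rank_back ?odd_w //; move: (m) (n); clear; lia. Qed.

Lemma rank_closing : rank w.+1 = 1%N.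
Proof. by rewrite rank_back ?leqnSn ?orbT //; clear; lia. Qed.

Lemma rank_entering : rank 0 = w.+2.
Proof. by rewrite rank_front // addn0. Qed.

(** A fold line at A, at E or at height 0 meets no strip but those it joins, and
one at height 1 can meet only the last half-wrap, which is below the whole
zigzag, and the entering strip. The latter lies to the left of the fold lines
from the index 2m on, and by [rank_between] it is not between the layers joined
by an earlier one. *)
Lemma band_layered : layered K.
Proof.
have M0 := M_gt0; have LM := L_big; have wM := T_ge; have ow := odd_w.
have resw k : (res k < w.+2)%N by rewrite ltn_pmod.
split.
- move=> i j [ij _]; rewrite !lies_over_band -leqNgt [RHS]leq_eqVlt.
  case: eqP => // e; case/eqP: ij.
  by rewrite nv_band (rank_inj _ _ e) // resw.
- move=> i j k p _ _ _ _ _ _; rewrite !lies_over_band => ij jk.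
  exact: ltn_trans jk ij.
- move=> i j p /open_fold_lineW/fold_regionP Fi /strip_regionP Sj.
  rewrite nv_band /between !lies_over_band next_mod.
  move: (xc p) (yc p) (res i) (res j) Fi Sj => X Y r s.
  case=> [rw YE XE|-> Y1 XT _|-> Y1 X0]; last 2 first.
  + by case=> [-> Y0 XM|_ Y01|-> _ _|->];
      rewrite /next ?(ltn_eqF (ltnSn w)) ?eqxx //; lra.
  + by case=> [->|_ Y01|-> Y0 XT|->]; rewrite /next ?eqxx //; lra.
  have -> : next r = r.+1 by rewrite /next (ltn_eqF (leqW rw)).
  have b01 : 0 <= ((odd r)%:R : R) <= 1 by rewrite ler0n lern1 leq_b1.
  case=> [-> Y0 XM|_ /andP[Y0 Y1]|-> Y0 _|_ Y1] sr sr1; last 3 first.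
  + by move: YE Y0 Y1; case: (odd r) => ->; rewrite ?mulr0n ?mulr1n; lra.
  + case: (eqVneq r.+1 w) => rE.
      have ro : odd r = false by move: ow; rewrite -rE /= => /negPf.
      by move: YE Y0; rewrite ro mulr0n; lra.
    have rw1 : (r.+1 < w)%N by rewrite ltn_neqAle rE.
    by rewrite !ltnNge !(ltnW (rank_low _)).
  + by rewrite YE in Y1; lra.
  rewrite rank_between //.
  (* The strip reaches the fold line at height 1 to the left of X = m - 1, and
     the fold line starts at X = r - m. *)
  have rm : r%:R < m.*2%:R :> R by rewrite -muln2 natrM; lra.
  by rewrite leqNgt -(ltr_nat R) rm.
- move=> i j p q; rewrite nv_band => ij _ /open_fold_lineW/fold_regionP Fi _.
  move=> /open_fold_lineW/fold_regionP Fj _ _.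
  rewrite /between !lies_over_band !next_mod.
  move: (xc p) (yc p) (res i) (res j) ij Fi Fj => X Y r s ne.
  have b01 (b : bool) : b%:R <= 1 :> R by rewrite lern1 leq_b1.
  case=> [rw YE _|rE Y1 XT _|rE Y1 X0]; case=> [sw YE' _|sE Y1' XT' _|sE Y1'
    X0'].
  + have oo : odd r = odd s.
      move/eqP: YE'; rewrite YE eqr_nat.
      by case: (odd r); case: (odd s).
    rewrite /next (ltn_eqF (leqW rw)) (ltn_eqF (leqW sw)).
    have [rs|rs] : (r.+1 < s)%N \/ (s.+1 < r)%N.
    + by move: rw sw oo ne; clear; lia.
    + by rewrite !rank_between //; move: rw sw rs; clear; lia.
    by rewrite !rank_between //; move: rw sw rs; clear; lia.
  + by have := b01 (odd r); lra.
  + by have := b01 (odd r); lra.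
  + by have := b01 (odd s); lra.
  + by rewrite rE sE eqxx in ne.
  + by lra.
  + by have := b01 (odd s); lra.
  + by lra.
  + by rewrite rE sE eqxx in ne.
Qed.

(** * Topological type, length and construction *)

Lemma odd_nv : odd w.+2. Proof. by rewrite 2!oddS negbK odd_w. Qed.

Lemma res_addnv k : res (k + w.+2) = res k. Proof. exact: modnDr. Qed.

(** One turn along the ribbon passes an odd number of folds, which is an odd
number of reflections. *)
Lemma band_mobius : mobius_band K.
Proof.
move=> s t p [k [-> kp]]; exists (k + w.+2)%N; split; last first.
  move: kp; rewrite /strip !fold_form_band !pre_mod !offset_band res_addnv.
  by [].
have sgn : (-1) ^+ w.+2 = -1 :> R by rewrite -signr_odd odd_nv expr1.
rewrite /folded_at /nrm !vt_band !dir_band res_addnv exprD sgn.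
rewrite /total_len nv_band [(k + _)%N]addnC big_split_ord /=.
under [X in _ = _ + (_ - (_ + X)) *: _ + _]eq_bigr => i _ do
  rewrite len_band modnDl -len_band.
rewrite mulrN1 mulrNN; congr (_ + _ *: _ + _).
by rewrite opprD addrA addrK.
Qed.

Lemma band_total_len : total_len K = (3 * T + 6 * L) / (M * s3).
Proof.
rewrite /total_len nv_band.
under eq_bigr => i _ do rewrite len_band modn_small //.
rewrite big_ord_recl !big_ord_recr /=.
under eq_bigr => i _.
  rewrite /edge_len /reach /=.
  have -> : (bump 0 i == w.+1) = false by have := ltn_ord i; rewrite /bump; lia.
  have -> : (bump 0 i == w) = false by have := ltn_ord i; rewrite /bump; lia.
  over.
rewrite sumr_const card_ord -mulr_natl /edge_len /reach !eqxx /=.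
have -> : (bump 0 (m.*2 + n.*2) == w.+1) = false by rewrite /bump; lia.
have M0 := lt0r_neq0 M_gt0; have s0 := lt0r_neq0 s3_gt0.
by field; rewrite ?M0 ?s0.
Qed.

Lemma acos_half : acos (2^-1) = pi / 3 :> R.
Proof.
have p0 := pi_gt0 R.
have c0 : 0 < cos (pi / 3 : R) by apply: cos_gt0_pihalf; lra.
have E : cos (pi / 3 : R) = 2^-1.
  have : cos (pi / 3 *+ 2) = cos (pi - pi / 3) :> R by congr cos;
    rewrite mulr2n; field.
  rewrite cos_mulr2n cosB cospi sinpi => e.
  have : (cos (pi / 3) + 1) * (2 * cos (pi / 3) - 1) = 0 :> R.
    by move: e; rewrite mulr2n; lra.
  move/eqP; rewrite mulf_eq0 => /orP[] /eqP; lra.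
by rewrite -E cosK // in_itv /=; lra.
Qed.

Lemma dot_dir_band k : dot (dir K k) (dir K k.+1) = - 2^-1.
Proof.
rewrite !dir_band next_mod.
have := ltn_pmod k (ltn0Sn w.+1); move: (res k) => r rw.
have ss := s3_sqr; have ow := odd_w; rewrite /next /dot.
case: (eqVneq r w.+1) => [->|r1].
  by rewrite /edge_dir eqxx /=; field.
rewrite {2 4}/edge_dir eqSS; case: (eqVneq r w) => [->|r2].
  by rewrite /edge_dir (ltn_eqF (ltnSn w)) ow /=; field.
rewrite /edge_dir (negPf r1) /=; case: (odd r) => /=.
  have -> : 2^-1 * 2^-1 + s3 / 2 * - (s3 / 2) = (1 - s3 * s3) / 4 by field.
  by rewrite ss; field.
have -> : 2^-1 * 2^-1 + - (s3 / 2) * (s3 / 2) = (1 - s3 * s3) / 4 by field.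
by rewrite ss; field.
Qed.

Lemma fold_angle_band k : fold_angle K k = pi / 3.
Proof.
rewrite /fold_angle -acos_half; congr acos.
have -> : dot (- dir K k) (dir K k.+1) = - dot (dir K k) (dir K k.+1).
  by rewrite /dot !mulNr -opprD.
by rewrite dot_dir_band opprK.
Qed.

Lemma cross_band k : cross (dir K k) (dir K k.+1) =
  if odd (res k) && (res k < w)%N then - (s3 / 2) else s3 / 2.
Proof.
rewrite !dir_band next_mod.
have := ltn_pmod k (ltn0Sn w.+1); move: (res k) => r rw.
have ow := odd_w; rewrite /next /cross.
case: (eqVneq r w.+1) => [->|r1].
  by rewrite ltnNge leqnSn andbF /edge_dir eqxx /=; field.
rewrite {2 4}/edge_dir eqSS; case: (eqVneq r w) => [->|r2].
  by rewrite ltnn andbF /edge_dir (ltn_eqF (ltnSn w)) ow /=; field.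
have -> : (r < w)%N by move: rw r1 r2; clear; lia.
by rewrite /edge_dir (negPf r1) andbT /=; case: (odd r) => /=; field.
Qed.

Lemma left_fold_band k : (k < w.+2)%N -> ~~ (odd k && (k < w)%N) -> left_fold K
  k.
Proof.
move=> kw ok; rewrite /left_fold cross_band modn_small // (negPf ok).
by have := s3_gt0; lra.
Qed.

Lemma right_fold_band k : odd k && (k < w)%N -> right_fold K k.
Proof.
move=> ok; rewrite /right_fold cross_band modn_small; last by move: ok; lia.
by rewrite ok; have := s3_gt0; lra.
Qed.

Lemma lies_over_small i j : (i < w.+2)%N -> (j < w.+2)%N ->
  lies_over K i j = (rank j < rank i)%N.
Proof. by move=> iw jw; rewrite lies_over_band !modn_small. Qed.

Lemma zigzag_len k : (0 < k < w)%N -> len K k = 2 / (M * s3).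
Proof.
move=> /andP[k0 kw]; rewrite len_band modn_small; last by move: kw; clear; lia.
rewrite /edge_len /reach (gtn_eqF k0) (ltn_eqF kw) (ltn_eqF (leqW kw)) /=.
by rewrite mulr1.
Qed.

Lemma band_construction : mobius_construction K (pi / 3) (2 / (M * s3)) m n.
Proof.
have m0 : (0 < m)%N by case: m m_odd.
have vt1 : vt K 1 = pt 0 0 by rewrite vt_band modn_small.
split.
- exact: nv_band.
- split.
  + split=> [i im|i im]; last by apply: zigzag_len; move: im; clear; lia.
    split; first exact: fold_angle_band.
      case oi: (odd i); first by apply: right_fold_band; rewrite oi /=;
        move: im; clear; lia.
      by apply: left_fold_band; rewrite ?oi //; move: im; clear; lia.
    rewrite /overfold lies_over_small; try by [move: im; clear; lia].
    by rewrite !rank_front //; move: im; clear; lia.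
  + by apply: zigzag_len; move: m0; clear; lia.
  + rewrite vt1 vt_band modn_small; last by clear; lia.
    rewrite nrm_band mod0n /vertex /vertex_x /vertex_y /=.
    rewrite ltnS leq_addr.
    rewrite dot_pt odd_double /xc /yc /pt /=.
    have M0 := lt0r_neq0 M_gt0; have s0 := lt0r_neq0 s3_gt0.
    have -> : m.*2%:R = 2 * M by rewrite -muln2 natrM mulrC.
    set x := (X in `|X|); have -> : x = 1 by rewrite /x mulr0n; field;
      rewrite ?M0 ?s0.
    by rewrite normr1.
- split=> [i im|i im|i j im jm _].
  + split; first exact: fold_angle_band.
    have o2 : odd (m.*2 + i) = odd i by rewrite oddD odd_double.
    rewrite /overfold /underfold; case oi: (odd i).
      split; first by apply: right_fold_band; rewrite o2 oi /=; move: im oi;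
        clear; lia.
      rewrite lies_over_small; try by [move: im; clear; lia].
      rewrite rank_back ?o2 ?oi //; last by case: i oi {im o2}; move=> // i _;
        clear; lia.
      rewrite rank_front; last first.
        by rewrite /= o2 oi /= orbC; move: im oi; clear; lia.
      by clear; lia.
    split; first by apply: left_fold_band; rewrite ?o2 ?oi //; move: im;
      clear; lia.
    rewrite lies_over_small; try by [move: im; clear; lia].
    rewrite rank_back /= ?o2 ?oi //; last by clear; lia.
    rewrite rank_front; last by rewrite /= o2 oi /=; move: im; clear; lia.
    by move: im; clear; lia.
  + by apply: zigzag_len; move: im; clear; lia.
  + have jr : rank j = (w.+2 + j)%N by apply: rank_front; move: jm; clear; lia.
    case oi: (odd i).
      rewrite lies_over_small; try by [move: im jm; clear; lia].
      rewrite jr rank_front; first by move: jm; clear; lia.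
      by rewrite /= oddD odd_double oi /= orbC; move: im oi; clear; lia.
    rewrite lies_over_small; try by [move: im jm; clear; lia].
    rewrite jr rank_back; first by move: jm; clear; lia.
      by clear; lia.
    by rewrite /= oddD odd_double oi.
- have ow := odd_w; have rw := rank_leaving; have rw1 := rank_closing.
  split; split; try by apply: left_fold_band;
    rewrite ?ltnn ?andbF //= negb_and; lia.
    by rewrite /underfold lies_over_small // rw rw1.
  by rewrite /overfold lies_over_band modnn modn_small // rw1 rank_front.
- split.
    rewrite edge_band modn_small // vt1 vt_band modn_small // /vertex /vertex_x
      /vertex_y /= ?ltnSn ?leqnn.
    by rewrite pt_sub /edge_dir eqxx /cross /= oddD !odd_double /GRing.scale /=
      mulr0n; ring.
  move=> j jm _; rewrite lies_over_small //; last by move: jm; clear; lia.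
  rewrite (@rank_front j); last by rewrite jm.
  by rewrite rank_back ?leqnSn ?orbT //; move: jm; clear; lia.
Qed.

(** * The knot type of the diagram *)

Lemma vertex_x_ltS k : (k < w.+1)%N -> vertex_x k < vertex_x k.+1.
Proof.
move=> kw; have L1 := L_gt1; have T0 : 0 <= T by apply: ler0n.
rewrite /vertex_x; case: k kw => [|k] kw /=; first by lra.
have -> : (k < w)%N by move: kw; clear; lia.
case: ifP => kw'; first by rewrite ltr_nat.
have -> : k = (m.*2 + n.*2)%N by move: kw kw'; clear; lia.
by lra.
Qed.

Lemma vertex_x_lt i j : (i < j < w.+2)%N -> vertex_x i < vertex_x j.
Proof.
case/andP; elim: j => // j IH ij jw.
have lt : vertex_x j < vertex_x j.+1 by apply: vertex_x_ltS.
have [->//|ne] := eqVneq i j.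
by apply: lt_trans lt; apply: IH; move: ij jw ne; clear; lia.
Qed.

(** The diagram itself is a lift of constant height 0: a polygon that is simple
already in the plane imposes no condition on the heights. *)
Lemma band_unknot_diagram : unknot_diagram K.
Proof.
pose h (k : nat) : seq (R * R) := [:: (0, 0)].
have ptsE k : lift_points K h k = [:: (vt K k, 0)].
  by rewrite /lift_points /= scale0r addr0.
have polyE : lift_polygon K h = [seq (vertex k, 0) | k <- iota 0 w.+2].
  rewrite /lift_polygon nv_band -[RHS]flatten_map1; congr flatten.
  apply/eq_in_map => k; rewrite mem_iota add0n => /andP[_ kw].
  by rewrite ptsE vt_band modn_small.
have flat k x : on_arc K h k x -> x.2 = 0.
  case=> i []; rewrite /lift_arc !ptsE /=.
  case: i => [|[|i]] // _ [t [_ _ ->]] /=.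
  by rewrite !scaler0 addr0.
have M0 := M_gt0; have s0 := s3_gt0.
have gP : garland (L / M) (lift_polygon K h).
  rewrite polyE /garland size_map size_iota.
  have nthE i : (i < w.+2)%N ->
      nth 0 [seq (vertex k, 0) | k <- iota 0 w.+2] i = (vertex i, 0) :> space R.
    by move=> iw; rewrite (nth_map 0%N) ?size_iota // nth_iota.
  split=> //.
  - move=> i j ij; rewrite !nthE /=; [|by case/andP: ij|by move: ij; clear;
      lia].
    by rewrite ltr_pM2r ?invr_gt0 ?mulr_gt0 // vertex_x_lt.
  - move=> i ei; rewrite nthE /=; last by case: ei => ->.
    by case: ei => ->; rewrite /vertex_y //= ltnn.
  - move=> i iw; rewrite nthE /=; last by move: iw; clear; lia.
    rewrite ltr_pM2r ?invr_gt0 // /vertex_y; have -> : (0 < i <= w)%N by [].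
    by apply: le_lt_trans L_gt1; rewrite lern1 leq_b1.
exists h; split.
- split=> [k|i j x y _ _ /flat x0 /flat y0 xy ne].
    by exists 0, [::].
  case: ne; move: x y xy x0 y0 => [x x'] [y y'] /= -> -> -> //.
- exact: garland_simple gP.
- exact: garland_unknotted gP.
Qed.

(** * Core and boundary as rails of the strips *)

(** The points of fold line k: its vertex for t = 0, its end on the first turn
of the boundary for t = m, and its end on the second turn for t = -m. *)
Definition node_x k (t : R) : R := vertex_x (next k) +
  (if k == w.+1 then - (t / 2) else if k == w then t / 2 else t).
Definition node_y k (t : R) : R := vertex_y (next k) - (if (w <= k)%N then t /
  2 else 0).
Definition node k t : plane R := pt (node_x k t) (node_y k t).

(** The segment across strip k that is parallel to its core and ends at [node k
t]: the core for t = 0, and the two sides for t = m and t = -m. *)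
Definition rail k (t X Y : R) : Prop :=
  if k == w.+1 then Y = L - t / 2 /\ - L - t / 2 <= X <= T + L + t / 2
  else if odd k then
    X - Y = k.-1%:R + t /\ 0 <= Y <= (if k == w then L - t / 2 else 1)
  else X + Y = k%:R + t /\ 0 <= Y <= (if k == 0%N then L + t / 2 else 1).

Lemma xc_pt X Y : xc (pt X Y) = X.
Proof.
have M0 := lt0r_neq0 M_gt0; have s0 := lt0r_neq0 s3_gt0.
by rewrite /xc /=; field; rewrite ?M0 ?s0.
Qed.

Lemma yc_pt X Y : yc (pt X Y) = Y.
Proof. by have M0 := lt0r_neq0 M_gt0; rewrite /yc /=; field; rewrite ?M0. Qed.

Lemma pt_coord p : pt (xc p) (yc p) = p.
Proof.
have M0 := lt0r_neq0 M_gt0; have s0 := lt0r_neq0 s3_gt0.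
case: p => x y; rewrite /pt /xc /yc /=.
by congr pair; field; rewrite ?M0 ?s0.
Qed.

Lemma seg_pt a b c d p : seg (pt a b) (pt c d) p <->
  exists t, [/\ 0 <= t, t <= 1, xc p = (1 - t) * a + t * c &
                yc p = (1 - t) * b + t * d].
Proof.
have comb t : (1 - t) *: pt a b + t *: pt c d =
    pt ((1 - t) * a + t * c) ((1 - t) * b + t * d).
  have -> : (1 - t) *: pt a b + t *: pt c d =
      ((1 - t) * (a / (M * s3)) + t * (c / (M * s3)),
       (1 - t) * (b / M) + t * (d / M)) by [].
  by rewrite /pt !mulrDl !mulrA.
split=> [[t [t0 t1 ->]]|[t [t0 t1 xE yE]]]; exists t; split=> //.
- by rewrite comb xc_pt.
- by rewrite comb yc_pt.
- by rewrite comb -xE -yE pt_coord.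
Qed.

Lemma convex_bounds (t b d : R) : 0 <= t -> t <= 1 -> d < b ->
  d <= (1 - t) * b + t * d <= b.
Proof.
move=> t0 t1 db.
have h1 : 0 <= t * (b - d) by rewrite mulr_ge0 // subr_ge0 ltW.
have h2 : 0 <= (1 - t) * (b - d) by rewrite mulr_ge0 ?subr_ge0 // ltW.
have -> : (1 - t) * b + t * d = b - t * (b - d) by ring.
have e : (1 - t) * (b - d) = b - t * (b - d) - d by ring.
by apply/andP; split; lra.
Qed.

(** Segments of slope -1, 1 and 0 are described by their line and an interval,
so that intersecting two rails becomes linear arithmetic. *)
Lemma seg_down a b c d e lo hi p :
  a + b = e -> c + d = e -> d = lo -> b = hi -> lo < hi ->
  seg (pt a b) (pt c d) p <-> xc p + yc p = e /\ lo <= yc p <= hi.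
Proof.
move=> ab cd <- <- db; rewrite seg_pt.
have bd0 : b - d != 0 by rewrite subr_eq0 gt_eqF.
split=> [[t [t0 t1 -> ->]]|[pe /andP[y1 y2]]].
  split; last exact: convex_bounds.
  have -> : a = e - b by lra.
  have -> : c = e - d by lra.
  by ring.
exists ((b - yc p) / (b - d)); split.
- by rewrite divr_ge0 ?subr_ge0 // ltW.
- by rewrite ler_pdivrMr ?subr_gt0 //; lra.
- have -> : xc p = e - yc p by lra.
  have -> : a = e - b by lra.
  have -> : c = e - d by lra.
  by field.
- by field.
Qed.

Lemma seg_up a b c d e lo hi p :
  a - b = e -> c - d = e -> b = lo -> d = hi -> lo < hi ->
  seg (pt a b) (pt c d) p <-> xc p - yc p = e /\ lo <= yc p <= hi.
Proof.
move=> ab cd <- <- db; rewrite seg_pt.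
have bd0 : d - b != 0 by rewrite subr_eq0 gt_eqF.
split=> [[t [t0 t1 -> ->]]|[pe /andP[y1 y2]]].
  split.
    have -> : a = e + b by lra.
    have -> : c = e + d by lra.
    by ring.
  have -> : (1 - t) * b + t * d = (1 - (1 - t)) * d + (1 - t) * b by ring.
  by apply: convex_bounds; lra.
exists ((yc p - b) / (d - b)); split.
- by rewrite divr_ge0 ?subr_ge0 // ltW.
- by rewrite ler_pdivrMr ?subr_gt0 //; lra.
- have -> : xc p = e + yc p by lra.
  have -> : a = e + b by lra.
  have -> : c = e + d by lra.
  by field.
- by field.
Qed.

Lemma seg_back a b c d e lo hi p :
  b = e -> d = e -> c = lo -> a = hi -> lo < hi ->
  seg (pt a b) (pt c d) p <-> yc p = e /\ lo <= xc p <= hi.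
Proof.
move=> -> -> <- <- ca; rewrite seg_pt.
have ac0 : a - c != 0 by rewrite subr_eq0 gt_eqF.
split=> [[t [t0 t1 -> ->]]|[-> /andP[y1 y2]]].
  by split; [ring|exact: convex_bounds].
exists ((a - xc p) / (a - c)); split.
- by rewrite divr_ge0 ?subr_ge0 // ltW.
- by rewrite ler_pdivrMr ?subr_gt0 //; lra.
- by field.
- by field.
Qed.

(** Strip 0 starts at A with the opposite parameter: fold w+1 closes up the band
with a change of sides. *)
Lemma railP k t p : (k < w.+2)%N -> - M <= t <= M ->
  seg (node (prev k) (if k == 0%N then - t else t)) (node k t) p <->
  rail k t (xc p) (yc p).
Proof.
move=> kw tM; have ow := odd_w; have M0 := M_gt0; have LM := L_big.
have wM := T_ge.
rewrite /node /rail /node_x /node_y /prev.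
case: (eqVneq k w.+1) => [->|k1].
  rewrite leqnn leqnSn /next eqxx (ltn_eqF (ltnSn w)) eqxx /=.
  by rewrite /vertex_x /vertex_y /= ltnn /=; apply: seg_back; lra.
case: (eqVneq k 0%N) => [->|k0].
  rewrite leqnSn /next eqxx /= /vertex_x /vertex_y /=.
  by apply: seg_down; rewrite ?mulr0n; lra.
have nk : next k.-1 = k.
  by rewrite /next; case: eqP => // e; move: e kw; clear -k0; lia.
have -> : (k.-1 == w.+1) = false by move: kw; clear; lia.
have -> : (k.-1 == w) = false by move: kw k0 k1; clear; lia.
have -> : (w <= k.-1)%N = false by move: kw k0 k1; clear; lia.
rewrite nk /next (negPf k1).
case: (eqVneq k w) => [->|k2].
  rewrite leqnn ow /vertex_x /vertex_y /= ltnn leqnn /= oddD !odd_double /=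
    mulr0n.
  by apply: seg_up; lra.
have kw' : (k < w)%N by move: kw k1 k2; clear; lia.
have -> : (w <= k)%N = false by rewrite leqNgt kw'.
rewrite /vertex_x /vertex_y (ltnW kw') kw' !subr0 (negPf k0) lt0n k0 /=.
case: k k0 {kw k1 k2 nk kw'} => // k _; rewrite /= -(natr1 k).
case: (odd k) => /=; rewrite ?mulr0n ?mulr1n.
  by apply: seg_down; lra.
by apply: seg_up; lra.
Qed.

(** The alternating sides of the boundary at the folds combine with the sign of
the turn: the second turn around the band, which has an odd number of folds,
exchanges the two sides. *)
Lemma sign_turn k : (-1) ^+ k = (-1) ^+ odd (res k) * (-1) ^+ (k %/ w.+2) :> R.
Proof.
rewrite {1}(divn_eq k w.+2) exprD mulnC exprM -[(-1) ^+ w.+2]signr_odd odd_nv.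
by rewrite expr1 mulrC signr_odd.
Qed.

Lemma bd_band k : bd K k = node (res k) ((-1) ^+ (k %/ w.+2) * M).
Proof.
rewrite /bd /fold_point sign_turn vt_band next_mod cross_band dot_dir_band
  nrm_band dir_band.
have := ltn_pmod k (ltn0Sn w.+1); move: ((-1) ^+ (k %/ w.+2)) (res k) => e r rw.
have ow := odd_w; have ss := s3_sqr.
have M0 := lt0r_neq0 M_gt0; have s0 := lt0r_neq0 s3_gt0.
rewrite /node /node_x /node_y /vertex.
move: (vertex_x (next r)) (vertex_y (next r)) => X Y.
have pairE (u v : plane R) : u.1 = v.1 -> u.2 = v.2 -> u = v.
  by case: u v => ? ? [? ?] /= -> ->.
have s3V : s3^-1 = s3 / 3 by apply: (mulIf s0);
  rewrite mulVf // mulrAC ss divff // pnatr_eq0.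
rewrite /edge_dir; case: (eqVneq r w.+1) => [->|r1].
  rewrite ltnNge leqnSn andbF [odd w.+1]oddS ow.
  apply: pairE; rewrite /pt /GRing.scale /= /GRing.scale /= ?invfM ?s3V expr0.
    by field; rewrite ?M0.
  by field; rewrite ?M0.
case: (eqVneq r w) => [->|r2].
  rewrite ltnn andbF leqnn ow /=.
  apply: pairE; rewrite /pt /GRing.scale /= /GRing.scale /= ?invfM ?s3V expr1.
    by field; rewrite ?M0.
  by field: ss; rewrite ?M0.
have rw' : (r < w)%N by move: rw r1 r2; clear; lia.
rewrite rw' leqNgt rw' andbT subr0; case: (odd r) => /=.
  apply: pairE; rewrite /pt /GRing.scale /= /GRing.scale /= ?invfM ?s3V expr1.
    by field; rewrite ?M0.
  by field: ss; rewrite ?M0.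
apply: pairE; rewrite /pt /GRing.scale /= /GRing.scale /= ?invfM ?s3V expr0.
  by field; rewrite ?M0.
by field: ss; rewrite ?M0.
Qed.

(** The parameter of the rail followed by the boundary along strip k, where k
counts strips over both turns. *)
Definition turn k : R := (-1) ^+ (k %/ w.+2) * M.

Lemma next_prev k : (k < w.+2)%N -> next (prev k) = k.
Proof.
rewrite /next /prev; case: k => [|k] kw; first by rewrite /= eqxx.
by rewrite /= (_ : (k == w.+1) = false) //; apply: ltn_eqF.
Qed.

Lemma prev_next k : (k < w.+2)%N -> prev (next k) = k.
Proof. by rewrite /next /prev => kw; case: (k =P w.+1) => [->|]. Qed.

Lemma vt_node k : vt K k = node (prev (res k)) 0.
Proof.
rewrite vt_band /node /node_x /node_y next_prev ?ltn_pmod //.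
by rewrite mul0r oppr0 !if_same addr0 subr0.
Qed.

Lemma core_seg k p :
  seg (vt K k) (vt K k.+1) p <-> rail (res k) 0 (xc p) (yc p).
Proof.
have kw := ltn_pmod k (ltn0Sn w.+1).
rewrite !vt_node next_mod prev_next // -railP //; last first.
  by have := M_gt0; lra.
by rewrite oppr0 if_same.
Qed.

Lemma turnP k : turn k = M \/ turn k = - M.
Proof.
rewrite /turn -signr_odd; case: (odd _); [right|left].
  by rewrite expr1 mulN1r.
by rewrite expr0 mul1r.
Qed.

Lemma bd_seg k p :
  seg (bd K k) (bd K k.+1) p <-> rail (res k.+1) (turn k.+1) (xc p) (yc p).
Proof.
have kw := ltn_pmod k (ltn0Sn w.+1).
rewrite -railP ?ltn_pmod //; last first.
  by have := M_gt0; case: (turnP k.+1) => ->; lra.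
rewrite !bd_band -/(turn _) -/(turn _) next_mod prev_next //.
have -> // : turn k = if next (res k) == 0%N then - turn k.+1 else turn k.+1.
rewrite /turn divnS // /dvdn next_mod; case: eqP => _ /=; last by rewrite add0n.
by rewrite exprS mulN1r mulNr opprK.
Qed.

(** * Crossings of the core with the boundary *)

(** Since m is odd, the defect of a = b + t is even for a and b of different
parity; it cannot be just 1. *)
Lemma odd_gap (a b : nat) t : t = M \/ t = - M -> odd a != odd b ->
  [\/ a%:R = b%:R + t, a%:R + 2 <= b%:R + t | b%:R + t + 2 <= a%:R].
Proof.
have cast (x y : nat) : (x + 2 <= y)%N -> x%:R + 2 <= y%:R :> R.
  by rewrite -(ler_nat R) natrD.
have mo := m_odd.
case=> -> ab.
  have [lt|lt|e] := ltngtP a (b + m)%N.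
  - apply: Or32; rewrite -!natrD ler_nat.
    by move: ab lt mo; clear; lia.
  - apply: Or33; rewrite -!natrD ler_nat.
    by move: ab lt mo; clear; lia.
  - by apply: Or31; rewrite e natrD.
have [lt|lt|e] := ltngtP (a + m)%N b.
- have := cast (a + m)%N b; rewrite natrD => h; apply: Or32.
  by have := h ltac:(move: ab lt mo; clear; lia); lra.
- have := cast b (a + m)%N; rewrite natrD => h; apply: Or33.
  by have := h ltac:(move: ab lt mo; clear; lia); lra.
- by apply: Or31; rewrite -e natrD; lra.
Qed.

Lemma odd_shift (a b : nat) t : t = M \/ t = - M -> a%:R = b%:R + t ->
  odd a != odd b.
Proof.
have mo := m_odd; case=> -> => [/eqP|e].
  by rewrite -natrD eqr_nat => /eqP ->; rewrite oddD mo; case: (odd b).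
have /eqP : a%:R + M = b%:R by lra.
by rewrite -natrD eqr_nat => /eqP <-; rewrite oddD mo; case: (odd a).
Qed.

Lemma w_gt : 2 * M + 1 <= w%:R.
Proof. by have := T_ge; have := natr_w; lra. Qed.

(** Rails of equal parity are parallel. Otherwise the height of the intersection
of the two lines is (1 + g)/2 or (1 - g)/2, where g = i - (j + t) is even by
[odd_gap]; so it is 1/2 for g = 0 and otherwise outside [0, 1], and above height
1 only the strips 0 and w remain, for which g has the wrong sign. *)
Lemma rail_cross i j t : (i <= w)%N -> (j <= w)%N -> t = M \/ t = - M ->
  (exists X Y, rail i 0 X Y /\ rail j t X Y) <-> i%:R = j%:R + t.
Proof.
move=> iw jw tM; have M0 := M_gt0; have LM := L_big; have wM := w_gt.
have tb : - M <= t <= M by case: tM => ->; lra.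
have pred k : odd k -> k.-1%:R = k%:R - 1 :> R.
  by case: k => // k _; rewrite -(natr1 k) /=; lra.
have iw1 : (i == w.+1) = false by move: iw; clear; lia.
have jw1 : (j == w.+1) = false by move: jw; clear; lia.
rewrite /rail iw1 jw1; split=> [[X [Y []]]|e].
  case oi: (odd i) => -[Xi Yi]; case oj: (odd j) => -[Xj Yj].
  - by move: Xi Xj; rewrite !pred //; lra.
  - case: (@odd_gap i j t tM); rewrite ?oi ?oj // => gap.
      move: Yi Yj; case: eqP => [iE|_]; case: eqP => [jE|_].
      + by move: gap; rewrite iE jE; lra.
      + by move: Xi; rewrite pred //; lra.
      + by move: Xi; rewrite pred //; lra.
      + by move: Xi; rewrite pred //; lra.
    by move: Xi; rewrite pred //; lra.
  - case: (@odd_gap i j t tM); rewrite ?oi ?oj // => gap.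
      by move: Xj; rewrite pred //; lra.
    move: Yi Yj; case: eqP => [iE|_]; case: eqP => [jE|_].
    + by move: gap; rewrite iE jE; lra.
    + by move: Xj; rewrite pred //; lra.
    + by move: Xj; rewrite pred //; lra.
    + by move: Xj; rewrite pred //; lra.
  - by lra.
have oij := odd_shift tM e.
have top (c : bool) (h : R) : 1 <= h -> 0 <= (1 / 2 : R) <= (if c then h else
  1).
  by move=> h1; case: c => /=; lra.
exists (i%:R - 1 / 2), (1 / 2).
move: oij; case oi: (odd i); case oj: (odd j) => // _.
  by rewrite (pred i oi); split; split; [lra|apply: top; lra|lra|apply: top;
    lra].
by rewrite (pred j oj); split; split; [lra|apply: top; lra|lra|apply: top; lra].
Qed.

(** The pairs of a core edge i and a strip j such that i crosses the side t = m
(e = false) or t = -m (e = true) of strip j. Besides the shifts by m inside the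
zigzag, these are two crossings of strips 0 and w+1 at A, and two crossings of
strips w and w+1 at E. *)
Definition meets (e : bool) i j : bool :=
  if e then (j == i + m)%N && (j <= w)%N || (i == w.+1) && (j == w)
  else (i == j + m)%N && (i <= w)%N || (i == w.+1) && (j == 0%N)
       || (j == w.+1) && ((i == 0%N) || (i == w)).

Lemma meetsP (e : bool) i j : (i < w.+2)%N -> (j < w.+2)%N ->
  (exists X Y, rail i 0 X Y /\ rail j ((-1) ^+ e * M) X Y) <-> meets e i j.
Proof.
move=> iw jw; have M0 := M_gt0; have LM := L_big; have wM := T_ge.
have m0 : (0 < m)%N by case: m m_odd.
have ow := odd_w.
set t := _ * M.
have tE : t = if e then - M else M.
  by rewrite /t; case: (e); rewrite ?expr1 ?expr0 ?mul1r ?mulN1r.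
clearbody t; have tM : t = M \/ t = - M by rewrite tE; case: (e); [right|left].
have w0 : (0 == w.+1)%N = false by [].
have ww : (w == w.+1)%N = false by rewrite ltn_eqF.
case: (eqVneq i w.+1) => [->|i1]; case: (eqVneq j w.+1) => [->|j1].
- have -> : meets e w.+1 w.+1 = false.
    by rewrite /meets eqxx; case: e {t tE tM}; move: m0; clear; lia.
  split=> // -[X [Y []]]; rewrite /rail eqxx => -[YE _] [YE' _].
  by move: tE; case: e; lra.
- have -> : meets e w.+1 j = if e then j == w else j == 0%N.
    by rewrite /meets eqxx; case: e {t tE tM}; move: m0 jw j1; clear; lia.
  rewrite /rail eqxx (negPf j1); split=> [[X [Y [[YE _]]]]|].
    case: (odd j) => -[XE].
      by case: eqP => [->|_]; move: tE; case: e; lra.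
    by case: eqP => [->|_]; move: tE; case: e; lra.
  case: e tE {tM} => tE /eqP ->; rewrite tE ?ow ?eqxx /=.
    by exists (T + L - M), L; split; split; lra.
  by exists (M - L), L; rewrite mulr0n; split; split; lra.
- have -> : meets e i w.+1 = ~~ e && ((i == 0%N) || (i == w)).
    by rewrite /meets eqxx; case: e {t tE tM}; move: m0 iw i1; clear; lia.
  rewrite /rail eqxx (negPf i1); split=> [[X [Y [Xi [YE _]]]]|].
    move: Xi; case: (odd i) => -[XE].
      by case: eqP => [->|_]; move: tE; case: e; rewrite ?orbT //; lra.
    by case: eqP => [->|_]; move: tE; case: e => //; lra.
  case: e tE {tM} => //= tE /orP[] /eqP ->; rewrite tE ?ow ?eqxx /=.
    by exists (- L + M / 2), (L - M / 2); rewrite mulr0n; split; split; lra.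
  by exists (T + L - M / 2), (L - M / 2); split; split; lra.
have {}iw : (i <= w)%N by move: iw i1; clear; lia.
have {}jw : (j <= w)%N by move: jw j1; clear; lia.
rewrite rail_cross // /meets (negPf i1) (negPf j1) iw jw /= tE.
case: e {t tE tM}; rewrite ?andbT ?orbF.
  have -> : (j == i + m)%N = (i%:R == j%:R - M).
    by rewrite -(eqr_nat R) natrD; apply/eqP/eqP; lra.
  by split=> /eqP.
by rewrite -(eqr_nat R) natrD; split=> /eqP.
Qed.

(** * Signs of the crossings and the linking number *)

Definition over_sign i j : R := if (rank j < rank i)%N
  then Num.sg (cross (edge_dir i) (edge_dir j)) else Num.sg (cross (edge_dir j)
    (edge_dir i)).

Definition rail_sign e i j : R := if meets e i j then over_sign i j else 0.

Lemma crossing_sign_band i k : (i < w.+2)%N ->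
  crossing_sign K i k = rail_sign (odd (k.+1 %/ w.+2)) i (res k.+1).
Proof.
move=> iw; rewrite /crossing_sign /rail_sign /over_sign !dir_band
  lies_over_band (modn_small iw).
have kw := ltn_pmod k.+1 (ltn0Sn w.+1).
congr (if _ then _ else _); apply/asboolP/idP => [[p []]|/meetsP].
  move=> /core_seg; rewrite modn_small // => pi /bd_seg pk.
  by apply/meetsP => //; exists (xc p), (yc p); rewrite signr_odd.
case=> // X [Y [ri rk]]; exists (pt X Y); split.
  by apply/core_seg; rewrite modn_small // xc_pt yc_pt.
by apply/bd_seg; rewrite xc_pt yc_pt /turn -signr_odd.
Qed.

(** Exchanging the two strips changes both the order of the layers and the
orientation of the directions. *)
Lemma over_signC i j : (i < w.+2)%N -> (j < w.+2)%N -> i != j ->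
  over_sign i j = over_sign j i.
Proof.
move=> iw jw ij; rewrite /over_sign; case: ltngtP => // /(rank_inj jw iw) e.
by rewrite e eqxx in ij.
Qed.

(** Strip k crosses strip k - m. In the accordion it is the upper one and its
direction alternates; a half-wrap is above or below according to its direction,
which makes the sign constant. *)
Definition zigzag_sign k : R := if (k <= m.*2)%N then (-1) ^+ k else 1.

Lemma over_sign_zigzag j : (j + m <= w)%N -> over_sign (j + m) j = zigzag_sign
  (j + m).
Proof.
move=> jw; have ow := odd_w; have mo := m_odd; have s0 := s3_gt0.
have m0 : (0 < m)%N by case: m m_odd.
have s30 : 0 < s3 / 2 by lra.
have oj : odd (j + m) = ~~ odd j by rewrite oddD mo addbT.
have c1 : cross (2^-1, s3 / 2) (2^-1, - (s3 / 2)) = - (s3 / 2) :> R.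
  by rewrite /cross /=; field.
have c2 : cross (2^-1, - (s3 / 2)) (2^-1, s3 / 2) = s3 / 2 :> R.
  by rewrite /cross /=; field.
rewrite /over_sign /zigzag_sign -signr_odd oj /edge_dir !ltn_eqF; [|lia|lia].
rewrite oj.
have [jm|jm] := leqP (j + m) m.*2.
  have -> : (rank j < rank (j + m))%N.
    by rewrite !rank_front //; [move: m0; clear; lia|rewrite jm|
      move: jm; clear; lia].
  by case: (odd j) => /=; rewrite ?c1 ?c2 ?sgrN gtr0_sg ?expr0 ?expr1.
have Rj : rank j = (w.+2 + j)%N \/ (m.*2 < j)%N /\ rank j = (w.+2 - j)%N.
  rewrite /rank; case: ifP => h; [by left|right; split=> //].
  by move: h; clear; lia.
case oj': (odd j) oj => /= oj.
  have jw' : (j + m < w)%N.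
    by rewrite ltn_neqAle jw andbT; apply/eqP => e; rewrite e ow in oj.
  rewrite (@rank_front (j + m)%N) ?oj ?jw' ?orbT //.
  have -> : (rank j < w.+2 + (j + m))%N by move: Rj m0; clear; lia.
  by rewrite c2 gtr0_sg.
rewrite (@rank_back (j + m)%N) ?oj //.
have -> : (rank j < w.+2 - (j + m))%N = false by move: Rj m0 jw; clear; lia.
by rewrite c2 gtr0_sg.
Qed.

Lemma over_sign_start : over_sign w.+1 0 = -1.
Proof.
have s0 := s3_gt0; have s30 : 0 < s3 / 2 by lra.
rewrite /over_sign rank_closing rank_entering /edge_dir eqxx /=.
rewrite (_ : cross _ _ = - (s3 / 2)); last by rewrite /cross /=; field.
by rewrite sgrN gtr0_sg.
Qed.

Lemma over_sign_end : over_sign w.+1 w = 1.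
Proof.
have s0 := s3_gt0; have s30 : 0 < s3 / 2 by lra.
have ow := odd_w.
rewrite /over_sign /edge_dir eqxx (ltn_eqF (ltnSn w)) ow.
rewrite rank_closing rank_leaving /=.
rewrite (_ : cross _ _ = s3 / 2); last by rewrite /cross /=; field.
by rewrite gtr0_sg.
Qed.

(** The two exceptional crossings at A are negative, those at E positive. *)
Lemma rail_signE e i j : (i < w.+2)%N -> (j < w.+2)%N -> rail_sign e i j =
  if e then (if (j == i + m)%N && (j <= w)%N then zigzag_sign j else 0)
            + (if (i == w.+1) && (j == w) then 1 else 0)
  else (if (i == j + m)%N && (i <= w)%N then zigzag_sign i else 0)
       + (if (i == w.+1) && (j == 0%N) then -1 else 0)
       + (if (i == 0%N) && (j == w.+1) then -1 else 0)
       + (if (i == w) && (j == w.+1) then 1 else 0).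
Proof.
move=> iw jw; have m0 : (0 < m)%N by case: m m_odd.
rewrite /rail_sign /meets; case: e.
  case: (altP (j =P i + m)%N) => [jE|_] /=.
    case: leqP => jw1 /=.
      have -> : (i == w.+1) = false by move: jE jw1; clear; lia.
      rewrite addr0 over_signC //; last by move: jE m0; clear; lia.
      by rewrite jE over_sign_zigzag // -jE.
    have -> : (j == w) = false by move: jw1; clear; lia.
    by rewrite andbF addr0.
  case: (eqVneq i w.+1) => [->|_] /=; last by rewrite addr0.
  by case: (eqVneq j w) => [->|_]; rewrite ?over_sign_end add0r.
case: (altP (i =P j + m)%N) => [iE|_] /=.
  case: (leqP i w) => iw1 /=; last first.
    have -> : i == w.+1 by move: iw iw1; clear; lia.
    have -> : (j == w.+1) = false by move: iE iw m0; clear; lia.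
    rewrite !andbF /= orbF; case: eqP => [j0|_]; rewrite ?addr0 ?add0r //.
    by rewrite j0 (_ : i = w.+1) ?over_sign_start //; move: iw iw1; clear; lia.
  have -> : (i == w.+1) = false by move: iw1; clear; lia.
  have -> : (j == w.+1) = false by move: iE iw m0; clear; lia.
  by rewrite !andbF !addr0 iE over_sign_zigzag // -iE.
rewrite add0r; case: (eqVneq i w.+1) => [->|i1] /=.
  have -> : (w.+1 == w) = false by clear; lia.
  rewrite andbF orbF !addr0.
  by case: eqP => [->|_] //; rewrite over_sign_start.
rewrite add0r; case: (eqVneq j w.+1) => [->|j1] /=;
  last by rewrite !andbF addr0.
rewrite !andbT; case: (eqVneq i 0%N) => [->|i0] /=.
  by rewrite addr0 over_signC // over_sign_start.
rewrite add0r; case: eqP => [->|//].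
by rewrite over_signC ?over_sign_end // ltn_eqF.
Qed.

Lemma sum_cross1 N a (c : R) : (a < N)%N ->
  \sum_(j < N) (if j == a :> nat then c else 0) = c.
Proof. by move=> aN; rewrite -big_mkcond (big_ord1_eq _ (fun=> c)) aN. Qed.

Lemma sum_corner N a b (c : R) : (a < N)%N -> (b < N)%N ->
  \sum_(i < N) \sum_(j < N) (if (i == a :> nat) && (j == b :> nat) then c else
    0)
  = c.
Proof.
move=> aN bN; rewrite -[RHS](sum_cross1 c aN); apply: eq_bigr => i _.
case: (_ == a) => /=; first exact: sum_cross1.
by rewrite big1.
Qed.

Lemma sum_alternating k : \sum_(i < k.*2) (-1) ^+ i = 0 :> R.
Proof.
elim: k => [|k IH]; first by rewrite big_ord0.
by rewrite doubleS !big_ord_recr /= IH add0r exprS mulN1r subrr.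
Qed.

(** The m+1 alternating signs of the indices m, ..., 2m cancel, as m is odd. *)
Lemma sum_zigzag_sign : \sum_(m <= i < w.+1) zigzag_sign i = n.*2.+1%:R.
Proof.
have mo := m_odd.
rewrite (@big_cat_nat _ _ _ m.*2.+1) /=; [|by clear; lia|by clear; lia].
have -> : \sum_(m <= i < m.*2.+1) zigzag_sign i = 0.
  rewrite -{1}[m]add0n big_addn big_mkord.
  have -> : (m.*2.+1 - m = (m./2.+1).*2)%N by move: mo; clear; lia.
  transitivity ((-1) ^+ m * \sum_(i < (m./2.+1).*2) (-1) ^+ i : R).
    2: by rewrite sum_alternating mulr0.
  rewrite mulr_sumr; apply: eq_bigr => i _; rewrite /zigzag_sign -exprD addnC.
  by have -> : (m + i <= m.*2)%N by have := ltn_ord i; move: mo; clear; lia.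
rewrite add0r (eq_big_nat _ _ (F2 := fun=> 1)); last first.
  by move=> i im; rewrite /zigzag_sign leqNgt; case/andP: im => ->.
rewrite sumr_const_nat; congr _%:R; clear; lia.
Qed.

Lemma sum_zigzag : \sum_(i < w.+2) \sum_(j < w.+2)
  (if (i == j + m :> nat)%N && (i <= w)%N then zigzag_sign i else 0) =
    n.*2.+1%:R.
Proof.
have m0 : (0 < m)%N by case: m m_odd.
rewrite -sum_zigzag_sign big_geq_mkord (big_ord_widen_cond w.+2 (fun i => m <=
  i)%N zigzag_sign) //.
rewrite [RHS]big_mkcond; apply: eq_bigr => i _; rewrite ltnS.
case: (leqP i w) => iw; last by rewrite andbF big1 // => j _; rewrite andbF.
case: (leqP m i) => im /=.
  rewrite -[RHS](@sum_cross1 w.+2 (i - m)); last by move: iw; clear; lia.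
  apply: eq_bigr => j _; rewrite andbT.
  by congr (if _ then _ else _); move: im; clear; lia.
rewrite big1 // => j _.
by have -> : (i == j + m :> nat)%N = false by move: im; clear; lia.
Qed.

(** In the zigzag the numbers X + Y and X - Y of a vertex are even, whereas the
boundary runs where one of them is odd; the other cases are decided by
inequalities. *)
Lemma band_general_position : general_position K.
Proof.
have M0 := M_gt0; have LM := L_big; have wM := w_gt; have wE := natr_w.
have ow := odd_w; have mo := m_odd.
move=> i k; split.
  move=> /bd_seg; rewrite vt_node xc_pt yc_pt.
  have tM := turnP k.+1; have tb : - M <= turn k.+1 <= M by case: tM => ->; lra.
  have t0 : turn k.+1 != 0 by apply/eqP; case: tM => ->; lra.
  move: tM tb t0.
  have := ltn_pmod i (ltn0Sn w.+1); have := ltn_pmod k.+1 (ltn0Sn w.+1).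
  move: (turn k.+1) (res k.+1) (res i) => t q r qw rw tM tb /eqP t0.
  rewrite /node_x /node_y /rail next_prev // mul0r oppr0 !if_same addr0 subr0.
  rewrite /vertex_x /vertex_y; case: (eqVneq q w.+1) => [_|q1].
    case=> + _; case: ifP => _ e; last by lra.
    have : (odd r.-1)%:R <= 1 :> R by rewrite lern1 leq_b1.
    by lra.
  have qle : q%:R <= w%:R :> R by rewrite ler_nat; move: qw q1; clear; lia.
  case: (eqVneq r 0%N) => [r0|r0] /=.
    rewrite r0 /=; case oq: (odd q) => -[e _].
      by have := ler0n R q.-1; lra.
    have : odd 0 != odd q by apply: odd_shift tM _; rewrite mulr0n; lra.
    by rewrite oq.
  rewrite lt0n r0 /=; case: (leqP r w) => rw' /=; last first.
    case oq: (odd q) => -[e _]; last by lra.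
    have : odd (m.*2 + n.*2) != odd q.-1 by apply: odd_shift tM _; lra.
    by case: q oq {qw q1 qle e} => //= q; rewrite oddD !odd_double;
      case: (odd q).
  case oq: (odd q) => -[e _].
    have : odd r.-1 != odd (q.-1 + odd r.-1)%N.
      by apply: odd_shift tM _; rewrite natrD; lra.
    by case: q oq {qw q1 qle e} => //= q /negPf oq; rewrite oddD oq oddb eqxx.
  have : odd (r.-1 + odd r.-1) != odd q by apply: odd_shift tM _;
    rewrite natrD; lra.
  by rewrite oddD oddb addbb oq.
move=> /core_seg; rewrite bd_band -/(turn k) xc_pt yc_pt.
have tM := turnP k; have tb : - M <= turn k <= M by case: tM => ->; lra.
have t0 : turn k != 0 by apply/eqP; case: tM => ->; lra.
move: tM tb t0.
have := ltn_pmod i (ltn0Sn w.+1); have := ltn_pmod k (ltn0Sn w.+1).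
move: (turn k) (res k) (res i) => t q r qw rw tM tb /eqP t0.
rewrite /node_x /node_y /rail /next mul0r oppr0 !addr0.
have [rE|r1] := eqVneq r w.+1.
  case=> + _; rewrite leqNgt; case: (ltnP q w) => qw' /=; last first.
    have -> : vertex_y (if q == w.+1 then 0%N else q.+1) = L; last by lra.
    case: (eqVneq q w.+1) => [_|q1]; first by rewrite /vertex_y.
    have -> : q = w by move: q1 qw qw'; clear; lia.
    by rewrite /vertex_y /= ltnn.
  rewrite (ltn_eqF (leqW qw')) /vertex_y /= qw'.
  have : (odd q)%:R <= 1 :> R by rewrite lern1 leq_b1.
  by lra.
have rle : r%:R <= w%:R :> R by rewrite ler_nat; move: rw r1; clear; lia.
have [qE|q1] := eqVneq q w.+1.
  rewrite qE leqnSn /vertex_x /vertex_y /=.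
  case or: (odd r) => -[e _].
    by have := ler0n R r.-1; lra.
  have : odd 0 != odd r by apply: odd_shift tM _; rewrite mulr0n; lra.
  by rewrite or.
have [qE|q2] := eqVneq q w.
  rewrite qE leqnn /vertex_x /vertex_y /= ltnn.
  case or: (odd r) => -[e _]; last by lra.
  have : odd r.-1 != odd (m.*2 + n.*2) by apply: odd_shift tM _; lra.
  by case: r or {rw r1 rle e} => //= r; rewrite oddD !odd_double; case: (odd r).
have qw' : (q < w)%N by move: qw q1 q2; clear; lia.
rewrite leqNgt qw' /vertex_x /vertex_y /= qw' subr0.
case or: (odd r) => -[e _].
  have : odd (r.-1 + odd q) != odd q by apply: odd_shift tM _; rewrite natrD;
    lra.
  case: r or {rw r1 rle e} => //= r /negPf or.
  by rewrite oddD or oddb eqxx.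
have : odd r != odd (q + odd q) by apply: odd_shift tM _; rewrite natrD; lra.
by rewrite oddD oddb addbb or.
Qed.

(** Two turns along the boundary pass both sides of every strip once. *)
Lemma band_linking : ribbon_linking_number K n.*2.+1%:R.
Proof.
split; first exact: band_general_position.
rewrite /bd_size nv_band odd_nv.
have rowE (i : 'I_w.+2) : \sum_(k < w.+2.*2) crossing_sign K i k =
    \sum_(j < w.+2) (rail_sign false i j + rail_sign true i j).
  (* Side k of the boundary lies in strip k+1, and F has period 2(w+2). *)
  pose F q := rail_sign (odd (q %/ w.+2)) i (res q).
  have -> : \sum_(k < w.+2.*2) crossing_sign K i k = \sum_(k < w.+2.*2) F k.+1.
    by apply: eq_bigr => k _; rewrite crossing_sign_band.
  have F0 : F w.+2.*2 = F 0%N.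
    by rewrite /F -muln2 mulnC mulnK // modnMl div0n mod0n.
  have -> : \sum_(k < w.+2.*2) F k.+1 = \sum_(k < w.+2.*2) F k.
    apply: (addrI (F 0%N)); rewrite -[in LHS](big_ord_recl _ (fun k => F k)).
    by rewrite big_ord_recr /= F0 addrC.
  rewrite -addnn big_split_ord big_split /=; congr (_ + _);
    apply: eq_bigr => j _.
    by rewrite /F divn_small // modn_small.
  by rewrite /F divnDl // divnn divn_small // modnDl modn_small.
under eq_bigr => i _ do rewrite rowE.
have cellsE (i j : 'I_w.+2) : rail_sign false i j + rail_sign true i j =
  (if (i == j + m :> nat)%N && (i <= w)%N then zigzag_sign i else 0)
  + (if (j == i + m :> nat)%N && (j <= w)%N then zigzag_sign j else 0)
  + (if (i == w.+1 :> nat) && (j == 0 :> nat)%N then -1 else 0)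
  + (if (i == 0 :> nat)%N && (j == w.+1 :> nat) then -1 else 0)
  + (if (i == w :> nat) && (j == w.+1 :> nat) then 1 else 0)
  + (if (i == w.+1 :> nat) && (j == w :> nat) then 1 else 0).
  by rewrite !rail_signE //; ring.
under eq_bigr => i _ do under eq_bigr => j _ do rewrite cellsE.
under eq_bigr => i _ do rewrite !big_split /=.
rewrite !big_split /= !sum_corner // sum_zigzag exchange_big /= sum_zigzag.
by field.
Qed.

End Band.

(** * The theorem *)

Theorem theorem11 (R : realType) (N : nat) (eps : R) (hN : odd N)
    (heps : 0 < eps) :
  exists K : ribbon R,
    [/\ width K = 1,
        folded_ribbon_unknot K /\ mobius_band K,
        ribbon_linking_number K N%:R \/ ribbon_linking_number K (- N%:R),
        ribbonlength K = 3 * Num.sqrt 3 + eps &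
        exists (d : R) (m n : nat), mobius_construction K (pi / 3) d m n].
Proof.
pose n := N./2; pose s3 : R := Num.sqrt 3.
have NE : N = n.*2.+1 by rewrite -[LHS]odd_double_half hN.
have s0 : 0 < s3 by apply: s3_gt0.
have es0 : 0 < eps * s3 by rewrite mulr_gt0.
(* The bound on m that makes the value of L below exceed m/2 + 1. *)
pose x := (n%:R + 1) * 6 / (eps * s3).
pose m := (Num.bound x).*2.+1.
have mo : odd m by rewrite /= odd_double.
have x0 : 0 <= x.
  by apply: divr_ge0; [rewrite mulr_ge0 ?addr_ge0 ?ler0n|exact: ltW].
have xm : x < m%:R.
  apply: lt_le_trans (archi_boundP x0) _; rewrite ler_nat /m -addnn.
  by rewrite -addSn leq_addl.
(* The solution of 6(m + n + L)/(m sqrt 3) = 3 sqrt 3 + eps. *)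
pose L : R := m%:R / 2 + m%:R * (eps * s3) / 6 - n%:R.
have L_big : m%:R / 2 + 1 < L.
  by move: xm; rewrite /x ltr_pdivrMr // /L; lra.
have m0 : m%:R != 0 :> R by rewrite pnatr_eq0.
exists (band m n L); split=> //.
- split; last exact: band_mobius.
  split; last exact: band_unknot_diagram.
  split=> //; [exact: band_polygonal|exact: band_immersed|].
  exact: band_layered.
- by left; rewrite NE; apply: band_linking.
- rewrite /ribbonlength divr1 band_total_len // -/s3.
  rewrite natrD -!muln2 !natrM /L.
  have ss : s3 * s3 = 3 by apply: s3_sqr.
  have s30 := lt0r_neq0 s0.
  by field: ss; rewrite ?m0 ?s30.
- by exists (2 / (m%:R * s3)), m, n; apply: band_construction.
Qed.
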